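(* The category $\mathbf{Lind}$ of Lindelöf spaces (the full subcategory of the category of completely regular spaces and continuous maps consisting of the Lindelöf spaces) is dually equivalent to the category $\mathbf{lbasic}$ of Lindelöf basic extensions.
   Context: Completely regular spaces are Hausdorff; a completely regular space is Lindelöf if each open cover has a countable subcover. An $\ell$-ring is a ring $A$ with $1$ and a partial order $\le$ making $A$ a lattice, such that $a\le b$ implies $a+c\le b+c$, and $0\le a,b$ implies $0\le ab$. It is bounded if for each $a$ there is $n\in\mathbb N$ with $a\le n\cdot 1$; archimedean if $na\le b$ for all $n\in\mathbb N$ implies $a\le 0$; an $\ell$-algebra if it is an $\mathbb R$-algebra and $0\le a\in A$, $0\le r\in\mathbb R$ imply $0\le ra$. Let $\mathbf{bal}$ be the category of bounded archimedean $\ell$-algebras and unital $\ell$-algebra homomorphisms. Real numbers $r$ are identified with $r\cdot 1$. $A\in\mathbf{bal}$ is uniformly complete if it is complete in the norm $\|a\|=\inf\{r\in\mathbb R: |a|\le r\}$, where $|a|=a\vee(-a)$; $\mathbf{ubal}$ is the full subcategory of $\mathbf{bal}$ of uniformly complete objects. $B\in\mathbf{bal}$ is Dedekind complete if each (nonempty) subset bounded above has a least upper bound. A basic algebra is a Dedekind complete $B\in\mathbf{bal}$ whose boolean algebra of idempotents is atomic. A unital $\ell$-algebra homomorphism between Dedekind complete algebras is normal if it preserves all existing joins (hence all existing meets). A basic extension is a monomorphism $\alpha:A\to B$ in $\mathbf{bal}$, with $B$ a basic algebra, such that each element of $B$ is a join of meets of elements of $\alpha[A]$. The category $\mathbf{basic}$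 has basic extensions as objects; a morphism from $\alpha:A\to B$ to $\alpha':A'\to B'$ is a pair $(\rho,\sigma)$ of morphisms $\rho:A\to A'$, $\sigma:B\to B'$ in $\mathbf{bal}$ with $\sigma$ normal and $\sigma\circ\alpha=\alpha'\circ\rho$; composition is componentwise. A basic extension $\alpha:A\to B$ satisfies (SL) if for all $S,T\subseteq A$: if $\bigwedge\alpha[S]\le\bigvee\alpha[T]$ (meet and join presupposed to exist in $B$), then there are countable subsets $S'\subseteq S$, $T'\subseteq T$, and $a\in A$ with $\bigwedge\alpha[S']\le\alpha(a)\le\bigvee\alpha[T']$. A basic extension $\alpha:A\to B$ is Lindelöf if $A\in\mathbf{ubal}$ and $\alpha$ satisfies (SL). $\mathbf{lbasic}$ is the full subcategory of $\mathbf{basic}$ consisting of Lindelöf basic extensions. *)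

(* Defs.v *)
From HB Require Import structures.
From mathcomp Require Import all_boot all_order all_algebra.
From mathcomp Require Import all_classical all_reals all_analysis.

Set Implicit Arguments.
Unset Strict Implicit.
Unset Printing Implicit Defensive.

Import Order.TTheory GRing.Theory Num.Theory.

Local Open Scope classical_set_scope.
Local Open Scope ring_scope.

(** * Categories *)

Record category := Category {
  obj :> Type;
  hom : obj -> obj -> Type;
  idm : forall x, hom x x;
  mcomp : forall x y z, hom y z -> hom x y -> hom x z;
  comp1m : forall x y (f : hom x y), mcomp (idm y) f = f;
  compm1 : forall x y (f : hom x y), mcomp f (idm x) = f;
  compmA : forall w x y z (h : hom y z) (g : hom x y) (f : hom w x),
    mcomp h (mcomp g f) = mcomp (mcomp h g) f }.

Arguments hom {c} x y.
Arguments idm {c} x.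
Arguments mcomp {c x y z} g f.

Definition op_category (C : category) : category :=
  @Category C (fun x y => hom y x) (fun x => idm x)
    (fun x y z g f => mcomp f g)
    (fun x y f => compm1 f) (fun x y f => comp1m f)
    (fun w x y z h g f => esym (compmA f g h)).

Definition full_subcategory (C : category) (P : C -> Prop) : category :=
  @Category {x : C | P x} (fun x y => hom (sval x) (sval y))
    (fun x => idm (sval x)) (fun x y z g f => mcomp g f)
    (fun x y f => comp1m f) (fun x y f => compm1 f)
    (fun w x y z h g f => compmA h g f).

Definition is_mono (C : category) (x y : C) (f : hom x y) : Prop :=
  forall (w : C) (g h : hom w x), mcomp f g = mcomp f h -> g = h.

Definition is_iso (C : category) (x y : C) (f : hom x y) : Prop :=
  exists g : hom y x, mcomp g f = idm x /\ mcomp f g = idm y.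

Record functor (C D : category) := Functor {
  fobj :> C -> D;
  fmap : forall x y, hom x y -> hom (fobj x) (fobj y);
  fmap1 : forall x, fmap (idm x) = idm (fobj x);
  fmapM : forall x y z (g : hom y z) (f : hom x y),
    fmap (mcomp g f) = mcomp (fmap g) (fmap f) }.

Arguments fmap {C D} F {x y} f : rename.

Definition id_functor (C : category) : functor C C :=
  @Functor C C id (fun x y f => f) (fun x => erefl) (fun x y z g f => erefl).

Section comp_functor.
Variables (C D E : category) (G : functor D E) (F : functor C D).

Let comp_fmap x y (f : hom x y) : hom (G (F x)) (G (F y)) := fmap G (fmap F f).

Lemma comp_fmap1 x : comp_fmap (idm x) = idm (G (F x)).
Proof. by rewrite /comp_fmap !fmap1. Qed.

Lemma comp_fmapM x y z (g : hom y z) (f : hom x y) :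
  comp_fmap (mcomp g f) = mcomp (comp_fmap g) (comp_fmap f).
Proof. by rewrite /comp_fmap !fmapM. Qed.

Definition comp_functor : functor C E := Functor comp_fmap1 comp_fmapM.

End comp_functor.

Definition naturally_isomorphic (C D : category) (F G : functor C D) : Prop :=
  exists eta : forall x, hom (F x) (G x),
    (forall x, is_iso (eta x)) /\
    (forall x y (f : hom x y),
      mcomp (eta y) (fmap F f) = mcomp (fmap G f) (eta x)).

Definition equivalent_categories (C D : category) : Prop :=
  exists (F : functor C D) (G : functor D C),
    naturally_isomorphic (comp_functor G F) (id_functor C) /\
    naturally_isomorphic (comp_functor F G) (id_functor D).

Definition dually_equivalent (C D : category) : Prop :=
  equivalent_categories (op_category C) D.

(** * Spaces *)

Record cregSpace := CregSpace {
  creg_space :> topologicalType;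
  creg_hausdorff : hausdorff_space creg_space;
  creg_regular : completely_regular_space creg_space }.

Record cregMap (X Y : cregSpace) := CregMap {
  creg_fun :> X -> Y;
  creg_cont : continuous creg_fun }.

Lemma cregMap_eq (X Y : cregSpace) (f g : cregMap X Y) :
  creg_fun f = creg_fun g -> f = g.
Proof.
case: f g => [f fc] [g gc] /= fg; case: _ / fg gc => gc.
by congr CregMap; exact: Prop_irrelevance.
Qed.

Definition cregMap_id (X : cregSpace) : cregMap X X :=
  @CregMap X X idfun (fun x => cvg_id).

Definition cregMap_comp (X Y Z : cregSpace) (g : cregMap Y Z) (f : cregMap X Y) :
    cregMap X Z :=
  @CregMap X Z (g \o f)
    (fun x => continuous_comp (@creg_cont _ _ f x) (@creg_cont _ _ g (f x))).

Definition CReg : category :=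
  @Category cregSpace cregMap cregMap_id cregMap_comp
    (fun X Y f => @cregMap_eq X Y (cregMap_comp (cregMap_id Y) f) f erefl)
    (fun X Y f => @cregMap_eq X Y (cregMap_comp f (cregMap_id X)) f erefl)
    (fun W X Y Z h g f => @cregMap_eq W Z
      (cregMap_comp h (cregMap_comp g f)) (cregMap_comp (cregMap_comp h g) f)
      erefl).

Definition lindelof (X : topologicalType) : Prop :=
  forall U : set (set X), U `<=` open -> \bigcup_(A in U) A = setT ->
    exists V : set (set X),
      [/\ V `<=` U, countable V & \bigcup_(A in V) A = setT].

Definition Lind : category := full_subcategory (fun X : CReg => lindelof X).

(** * Bounded archimedean l-algebras *)

(* The carrier is a possibly trivial ring ([pzRingType]): the zero algebra
   corresponds to the empty space.  The library has no structure that combines a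
   lattice with a possibly trivial ring or algebra, so order and scaling are given
   here by raw operations, from which the library structures are built below. *)
Record lalgebra (R : realType) := LAlgebra {
  lalg_ring : pzRingType;
  lalg_le : rel lalg_ring;
  lalg_meet : lalg_ring -> lalg_ring -> lalg_ring;
  lalg_join : lalg_ring -> lalg_ring -> lalg_ring;
  lalg_scale : R -> lalg_ring -> lalg_ring;
  lalg_le_refl : reflexive lalg_le;
  lalg_le_anti : antisymmetric lalg_le;
  lalg_le_trans : transitive lalg_le;
  lalg_meetP : forall a b c,
    lalg_le a (lalg_meet b c) = lalg_le a b && lalg_le a c;
  lalg_joinP : forall a b c,
    lalg_le (lalg_join a b) c = lalg_le a c && lalg_le b c;
  lalg_leD : forall a b c, lalg_le a b -> lalg_le (a + c) (b + c);
  lalg_mul_ge0 : forall a b, lalg_le 0 a -> lalg_le 0 b -> lalg_le 0 (a * b);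
  lalg_scaleA : forall r s a,
    lalg_scale r (lalg_scale s a) = lalg_scale (r * s) a;
  lalg_scale1 : left_id 1 lalg_scale;
  lalg_scaleDr : right_distributive lalg_scale +%R;
  lalg_scaleDl : forall a, {morph lalg_scale^~ a : r s / r + s};
  lalg_scaleAl : forall r a b, lalg_scale r (a * b) = lalg_scale r a * b;
  lalg_scaleAr : forall r a b, lalg_scale r (a * b) = a * lalg_scale r b;
  lalg_scale_ge0 : forall r a,
    0 <= r -> lalg_le 0 a -> lalg_le 0 (lalg_scale r a) }.

Definition lalg_sort (R : realType) (A : lalgebra R) : Type := lalg_ring A.
Coercion lalg_sort : lalgebra >-> Sortclass.

HB.instance Definition _ (R : realType) (A : lalgebra R) :=
  GRing.PzRing.copy (lalg_sort A) (lalg_ring A).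
HB.instance Definition _ (R : realType) (A : lalgebra R) :=
  GRing.Zmodule_isLmodule.Build R (lalg_sort A)
    (@lalg_scaleA R A) (@lalg_scale1 R A) (@lalg_scaleDr R A)
    (@lalg_scaleDl R A).
HB.instance Definition _ (R : realType) (A : lalgebra R) :=
  Order.Le_isPOrder.Build ring_display (lalg_sort A)
    (@lalg_le_refl R A) (@lalg_le_anti R A) (@lalg_le_trans R A).
HB.instance Definition _ (R : realType) (A : lalgebra R) :=
  Order.POrder_MeetJoin_isLattice.Build ring_display (lalg_sort A)
    (@lalg_meetP R A) (@lalg_joinP R A).

Record balType (R : realType) := BalType {
  bal_lalg :> lalgebra R;
  bal_bounded : forall a : bal_lalg, exists n : nat, a <= n%:R;
  bal_archimedean : forall a b : bal_lalg,
    (forall n : nat, a *+ n <= b) -> a <= 0 }.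

Record balHom (R : realType) (A B : balType R) := BalHom {
  bal_fun :> A -> B;
  balHomD : {morph bal_fun : a b / a + b};
  balHomM : {morph bal_fun : a b / a * b};
  balHom1 : bal_fun 1 = 1;
  balHomZ : forall r : R, {morph bal_fun : a / r *: a};
  balHom_meet : {morph bal_fun : a b / Order.meet a b};
  balHom_join : {morph bal_fun : a b / Order.join a b} }.

Section bal.
Variable R : realType.

Lemma balHom_eq (A B : balType R) (f g : balHom A B) :
  bal_fun f = bal_fun g -> f = g.
Proof.
case: f g => [f fD fM f1 fZ fI fU] [g gD gM g1 gZ gI gU] /= fg.
case: _ / fg gD gM g1 gZ gI gU => *.
by congr BalHom; exact: Prop_irrelevance.
Qed.

Definition balHom_id (A : balType R) : balHom A A :=
  @BalHom R A A idfun (fun _ _ => erefl) (fun _ _ => erefl) erefl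
    (fun _ _ => erefl) (fun _ _ => erefl) (fun _ _ => erefl).

Definition balHom_comp (A B C : balType R) (g : balHom B C) (f : balHom A B) :
  balHom A C.
Proof.
apply: (@BalHom R A C (g \o f)) => [a b|a b||r a|a b|a b] /=.
- by rewrite !balHomD.
- by rewrite !balHomM.
- by rewrite !balHom1.
- by rewrite !balHomZ.
- by rewrite !balHom_meet.
- by rewrite !balHom_join.
Defined.

Definition bal : category :=
  @Category (balType R) (@balHom R) balHom_id balHom_comp
    (fun A B f => @balHom_eq A B (balHom_comp (balHom_id B) f) f erefl)
    (fun A B f => @balHom_eq A B (balHom_comp f (balHom_id A)) f erefl)
    (fun A B C D h g f => @balHom_eq A D
      (balHom_comp h (balHom_comp g f)) (balHom_comp (balHom_comp h g) f)
      erefl).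

(* In the zero algebra the set below is all of R, and [inf] gives the norm 0. *)
Definition lnorm (A : balType R) (a : A) : R :=
  inf [set r : R | Order.join a (- a) <= r *: (1 : A)].

Definition uniformly_complete (A : balType R) : Prop :=
  forall u : nat -> A,
    (forall e : R, 0 < e -> exists N, forall m n,
      (N <= m)%N -> (N <= n)%N -> lnorm (u m - u n) < e) ->
    exists l : A, forall e : R, 0 < e -> exists N, forall n,
      (N <= n)%N -> lnorm (u n - l) < e.

(** * Basic extensions *)

Definition dedekind_complete (B : balType R) : Prop :=
  forall S : set B, has_sup S -> supremums S !=set0.

Definition idem (B : balType R) (e : B) : Prop := e * e = e.

(* In the boolean algebra of idempotents, meet is multiplication. *)
Definition idem_le (B : balType R) (e f : B) : Prop := e * f = e.

Definition idem_atom (B : balType R) (e : B) : Prop :=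
  [/\ idem e, e <> 0 &
    forall f : B, idem f -> idem_le f e -> f = 0 \/ f = e].

Definition idempotents_atomic (B : balType R) : Prop :=
  forall e : B, idem e -> e <> 0 ->
    exists2 f : B, idem_atom f & idem_le f e.

Definition basic_algebra (B : balType R) : Prop :=
  dedekind_complete B /\ idempotents_atomic B.

Definition normal_hom (B B' : balType R) (s : balHom B B') : Prop :=
  forall (S : set B) (b : B), supremums S b -> supremums (s @` S) (s b).

Definition join_meet_dense (A B : balType R) (alpha : balHom A B) : Prop :=
  forall b : B, exists2 D : set B,
    (forall d, D d -> exists S : set A, infimums (alpha @` S) d) &
    supremums D b.

Record basicExt := BasicExt {
  ext_dom : balType R;
  ext_cod : balType R;
  ext_map :> balHom ext_dom ext_cod;
  ext_mono : @is_mono bal ext_dom ext_cod ext_map;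
  ext_basic : basic_algebra ext_cod;
  ext_dense : join_meet_dense ext_map }.

Record basicHom (a a' : basicExt) := BasicHom {
  hom_dom : balHom (ext_dom a) (ext_dom a');
  hom_cod : balHom (ext_cod a) (ext_cod a');
  hom_normal : normal_hom hom_cod;
  hom_square : balHom_comp hom_cod a = balHom_comp a' hom_dom }.

Lemma basicHom_eq (a a' : basicExt) (f g : basicHom a a') :
  hom_dom f = hom_dom g -> hom_cod f = hom_cod g -> f = g.
Proof.
case: f g => [r s n c] [r' s' n' c'] /= rr' ss'.
case: _ / rr' c'; case: _ / ss' n' => n' c'.
by congr BasicHom; exact: Prop_irrelevance.
Qed.

Definition basicHom_id (a : basicExt) : basicHom a a.
Proof.
apply: (@BasicHom a a (balHom_id _) (balHom_id _)).
- by move=> S b Sb /=; rewrite image_id.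
- exact: balHom_eq.
Defined.

Definition basicHom_comp (a b c : basicExt) (g : basicHom b c)
  (f : basicHom a b) : basicHom a c.
Proof.
apply: (@BasicHom a c (balHom_comp (hom_dom g) (hom_dom f))
                      (balHom_comp (hom_cod g) (hom_cod f))).
- move=> S x Sx; have /= := hom_normal g (hom_normal f Sx).
  by rewrite -image_comp.
- apply: balHom_eq; apply/funext => x /=.
  have /(congr1 (fun h => bal_fun h x)) /= fE := hom_square f.
  have /(congr1 (fun h => bal_fun h (hom_dom f x))) /= gE := hom_square g.
  by rewrite fE gE.
Defined.

Definition basic : category.
Proof.
apply: (@Category basicExt basicHom basicHom_id basicHom_comp).
- by move=> a b f; apply: basicHom_eq; exact: balHom_eq.
- by move=> a b f; apply: basicHom_eq; exact: balHom_eq.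
- by move=> a b c d h g f; apply: basicHom_eq; exact: balHom_eq.
Defined.

(* (SL): the existence of the meets and joins involved is part of both the
   hypothesis and the conclusion. *)
Definition SL (alpha : basicExt) : Prop :=
  forall (S T : set (ext_dom alpha)) (s t : ext_cod alpha),
    infimums (alpha @` S) s -> supremums (alpha @` T) t -> s <= t ->
    exists (S' T' : set (ext_dom alpha)) (s' t' : ext_cod alpha)
        (a : ext_dom alpha),
      [/\ S' `<=` S /\ countable S', T' `<=` T /\ countable T',
          infimums (alpha @` S') s', supremums (alpha @` T') t' &
          s' <= alpha a /\ alpha a <= t'].

Definition lindelof_ext (alpha : basicExt) : Prop :=
  uniformly_complete (ext_dom alpha) /\ SL alpha.

Definition lbasic : category :=
  full_subcategory (fun alpha : basic => lindelof_ext alpha).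

End bal.

(* Main.v *)
(* A space X is sent to the inclusion of the algebra C*(X) of bounded continuous
   functions into the algebra B(X) of all bounded functions, and an extension
   alpha : A -> B to the space of normal homomorphisms p : B -> R, whose basic
   open sets are the {p | 0 < p (alpha a)}.

   In a Dedekind complete bounded archimedean l-algebra every w is nonnegative on
   some idempotent f and nonpositive on 1 - f; hence multiplication by an atom e
   is scalar, b e = p(b) e, the p's so obtained are exactly the points, and
   atomicity makes B the algebra of all bounded functions on its points.

   (SL) replaces both the Stone-Weierstrass theorem and compactness.  A bounded
   continuous f on the points is the meet of {a in A | f <= a} and the join of
   {a in A | a <= f}, so that (SL) produces an a in A equal to f; and (SL) applied
   to 1 <= \/ T, where T is the set of a <= 1 whose cozero set lies in a member of
   a given open cover, produces a countable subcover.

   Conversely, on a Lindelof space /\ S <= \/ T yields sequences F in S and G in T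
   with inf F <= sup G, between which a continuous function is interpolated
   explicitly. *)
From HB Require Import structures.
From mathcomp Require Import all_boot all_order all_algebra.
From mathcomp Require Import all_classical all_reals all_analysis.
From mathcomp Require Import ring lra.
Require Import Defs.

Set Implicit Arguments.
Unset Strict Implicit.
Unset Printing Implicit Defensive.

Import Order.TTheory GRing.Theory Num.Theory numFieldNormedType.Exports.

Local Open Scope classical_set_scope.
Local Open Scope ring_scope.

(** * Generalities on categories and l-algebras *)

Lemma naturally_isomorphic_sym (C D : category) (F G : functor C D) :
  naturally_isomorphic F G -> naturally_isomorphic G F.
Proof.
move=> [eta [iso nat]].
pose inv x := sval (cid (iso x)).
have invl x : mcomp (inv x) (eta x) = idm (F x) by case: (svalP (cid (iso x))).
have invr x : mcomp (eta x) (inv x) = idm (G x) by case: (svalP (cid (iso x))).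
exists inv; split=> [x|x y f]; first by exists (eta x).
by rewrite -[LHS]compm1 -(invr x) compmA -(compmA _ _ (eta x)) -nat compmA
  invl comp1m.
Qed.

(** * The reals as a bounded archimedean l-algebra *)

Section real_balType.
Variable R : realType.

Definition real_lalgebra : lalgebra R.
Proof.
apply: (@LAlgebra R R (fun x y => x <= y) Num.min Num.max *%R).
- exact: le_refl.
- exact: le_anti.
- exact: le_trans.
- by move=> a b c; rewrite le_min.
- by move=> a b c; rewrite ge_max.
- by move=> a b c; rewrite lerD2r.
- exact: mulr_ge0.
- by move=> r s a; rewrite mulrA.
- exact: mul1r.
- exact: mulrDr.
- by move=> a r s; rewrite mulrDl.
- by move=> r a b; rewrite mulrA.
- by move=> r a b; rewrite mulrCA.
- exact: mulr_ge0.
Defined.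

Lemma le_nat_bound (x : R) : x <= (Num.bound `|x|)%:R.
Proof. by apply: le_trans (ler_norm _) _; rewrite ltW// archi_boundP. Qed.

Lemma archimedean_le0 (x y : R) : (forall n, x *+ n <= y) -> x <= 0.
Proof.
move=> xy; rewrite leNgt; apply/negP => x0.
have : x *+ Num.bound (`|y| / x) <= y by exact: xy.
apply/negP; rewrite -ltNge -mulr_natl -ltr_pdivrMr//.
apply: le_lt_trans (archi_boundP _); last by rewrite divr_ge0// ltW.
by rewrite ler_pM2r ?invr_gt0// ler_norm.
Qed.

Definition real_balType : balType R.
Proof.
apply: (@BalType R real_lalgebra).
- move=> a; exists (Num.bound `|a : R|); exact: le_nat_bound.
- exact: archimedean_le0.
Defined.

End real_balType.

(** * Arithmetic of l-algebras, positive and negative parts *)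

Section lalgebra_theory.
Context {R : realType} {A : lalgebra R}.
Implicit Types (a b c : A) (r s : R).

Lemma lalg_lerD2r c a b : (a + c <= b + c) = (a <= b).
Proof.
apply/idP/idP => [h|]; last exact: lalg_leD.
by have := @lalg_leD R A _ _ (- c) h; rewrite !addrK.
Qed.

Lemma lalg_lerD2l c a b : (c + a <= c + b) = (a <= b).
Proof. by rewrite ![c + _]addrC lalg_lerD2r. Qed.

Lemma lalg_lerD a b c d : a <= b -> c <= d -> a + c <= b + d :> A.
Proof.
by move=> ab cd; apply: (@le_trans _ _ (b + c));
  rewrite ?lalg_lerD2r ?lalg_lerD2l.
Qed.

Lemma lalg_subr_ge0 a b : (0 <= b - a) = (a <= b).
Proof. by rewrite -[LHS](lalg_lerD2r a) add0r subrK. Qed.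

Lemma lalg_subr_le0 a b : (b - a <= 0) = (b <= a).
Proof. by rewrite -[LHS](lalg_lerD2r a) add0r subrK. Qed.

Lemma lalg_lerBlDr a b c : (a - b <= c) = (a <= c + b).
Proof. by rewrite -[LHS](lalg_lerD2r b) subrK. Qed.

Lemma lalg_lerBrDr a b c : (a <= b - c) = (a + c <= b).
Proof. by rewrite -[LHS](lalg_lerD2r c) subrK. Qed.

Lemma lalg_lerN2 a b : (- a <= - b) = (b <= a).
Proof. by rewrite -[LHS]lalg_subr_ge0 opprK addrC lalg_subr_ge0. Qed.

Lemma lalg_lerNr a b : (a <= - b) = (b <= - a).
Proof. by rewrite -{1}[a]opprK lalg_lerN2. Qed.

Lemma lalg_addr_ge0 a b : 0 <= a -> 0 <= b -> 0 <= a + b.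
Proof. by move=> a0 b0; rewrite -[0]addr0; exact: lalg_lerD. Qed.

Lemma lalg_mulr_ge0 a b : 0 <= a -> 0 <= b -> 0 <= a * b.
Proof. exact: lalg_mul_ge0. Qed.

Lemma lalg_ler_wpM2l c a b : 0 <= c -> a <= b -> c * a <= c * b.
Proof.
by move=> c0 ab; rewrite -lalg_subr_ge0 -mulrBr lalg_mulr_ge0 ?lalg_subr_ge0.
Qed.

Lemma lalg_ler_wpM2r c a b : 0 <= c -> a <= b -> a * c <= b * c.
Proof.
by move=> c0 ab; rewrite -lalg_subr_ge0 -mulrBl lalg_mulr_ge0 ?lalg_subr_ge0.
Qed.

Lemma lalg_scaler_ge0 r a : 0 <= r -> 0 <= a -> 0 <= r *: a.
Proof. exact: lalg_scale_ge0. Qed.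

Lemma lalg_lerZl r a b : 0 <= r -> a <= b -> r *: a <= r *: b.
Proof.
by move=> r0 ab; rewrite -lalg_subr_ge0 -scalerBr lalg_scaler_ge0
  ?lalg_subr_ge0.
Qed.

Lemma lalg_lerZr a r s : 0 <= a -> r <= s -> r *: a <= s *: a.
Proof.
by move=> a0 rs; rewrite -lalg_subr_ge0 -scalerBl lalg_scaler_ge0 ?subr_ge0.
Qed.

Lemma lalg_scalerAl r a b : r *: (a * b) = (r *: a) * b.
Proof. exact: lalg_scaleAl. Qed.

Lemma lalg_scalerAr r a b : r *: (a * b) = a * (r *: b).
Proof. exact: lalg_scaleAr. Qed.

Lemma lalg_opp_join a b : - (Order.join a b) = Order.meet (- a) (- b).
Proof.
apply: le_anti; rewrite lexI !lalg_lerN2 leUl leUr /=.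
by rewrite lalg_lerNr leUx (lalg_lerNr a) (lalg_lerNr b) leIl leIr.
Qed.

Lemma lalg_joinDr c a b : Order.join a b + c = Order.join (a + c) (b + c).
Proof.
apply: le_anti; rewrite leUx !lalg_lerD2r leUl leUr andbT.
by rewrite -lalg_lerBrDr leUx !lalg_lerBrDr leUl leUr.
Qed.

Lemma lalg_meetDr c a b : Order.meet a b + c = Order.meet (a + c) (b + c).
Proof.
apply: le_anti; rewrite lexI !lalg_lerD2r leIl leIr /=.
by rewrite -lalg_lerBlDr lexI !lalg_lerBlDr leIl leIr.
Qed.

(** Translating [- (a \/ b) = (- a) /\ (- b)] by [a + b] turns its right side into [b /\ a]. *)
Lemma lalg_join_meet a b : Order.join a b + Order.meet a b = a + b.
Proof.
have := lalg_meetDr (a + b) (- a) (- b).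
rewrite -lalg_opp_join addKr [a + b]addrC addKr meetC => <-.
by rewrite addrA subrr add0r.
Qed.

Definition lalg_pos a : A := Order.join a 0.
Definition lalg_neg a : A := Order.join (- a) 0.

Lemma lalg_pos_ge0 a : 0 <= lalg_pos a. Proof. exact: leUr. Qed.
Lemma lalg_neg_ge0 a : 0 <= lalg_neg a. Proof. exact: leUr. Qed.

Lemma lalg_posBneg a : a = lalg_pos a - lalg_neg a.
Proof.
apply/eqP; rewrite -subr_eq opprK /lalg_pos /lalg_neg addrC lalg_joinDr.
by rewrite addNr add0r joinC.
Qed.

(** Since the positive part is [a] plus the negative part, the latter factors out of the meet and
    leaves [a /\ 0], which is its opposite. *)
Lemma lalg_pos_meet_neg a : Order.meet (lalg_pos a) (lalg_neg a) = 0.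
Proof.
have e : lalg_pos a = a + lalg_neg a by rewrite {2}(lalg_posBneg a) subrK.
rewrite e -{2}[lalg_neg a]add0r -lalg_meetDr.
have -> : Order.meet a 0 = - lalg_neg a.
  by rewrite lalg_opp_join opprK oppr0.
by rewrite addNr.
Qed.

(** Subtracting [a] from [z = (a + b) /\ c] gives something below both [b] and [c], hence below 0.
    So [z] is below both [a] and [c]. *)
Lemma lalg_meet_addl a b c : 0 <= a -> Order.meet a c <= 0 ->
  Order.meet b c <= 0 -> Order.meet (a + b) c <= 0.
Proof.
move=> a0 ac bc; set z := Order.meet _ _.
have za : z <= a.
  rewrite -lalg_subr_le0; apply: le_trans bc; rewrite lexI.
  rewrite !lalg_lerBlDr [b + a]addrC leIl /=.
  by apply: (le_trans (leIr _ _)); rewrite -{1}[c]addr0 lalg_lerD2l.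
by apply: le_trans ac; rewrite lexI za leIr.
Qed.

End lalgebra_theory.

Section balType_theory.
Context {R : realType} {A : balType R}.
Implicit Types (a b c : A) (r s : R).

(** Positivity of 1 is not among the axioms. It comes from boundedness: [-1 <= n] gives
    [0 <= n + 1], and the real number [n + 1] can be divided out. *)
Lemma bal_ler01 : 0 <= 1 :> A.
Proof.
have [n /(lalg_leD 1)] := bal_bounded (- 1 : A).
rewrite addNr => h; have := lalg_scaler_ge0 (r := (n%:R + 1)^-1) _ h.
have n0 : 0 < n%:R + 1 :> R by rewrite ltr_wpDl.
rewrite invr_ge0 (ltW n0) => /(_ isT).
have -> : n%:R + 1 = (n%:R + 1) *: (1 : A) :> A.
  by rewrite scalerDl scale1r scaler_nat.
by rewrite scalerA mulVf ?scale1r// gt_eqF.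
Qed.

Lemma bal_ub a : exists2 r : R, 0 < r & a <= r *: (1 : A).
Proof.
have [n an] := bal_bounded a; exists (n%:R + 1); first by rewrite ltr_wpDl.
apply: (le_trans an); rewrite scalerDl scaler_nat scale1r -{1}[n%:R]addr0.
by rewrite lalg_lerD2l bal_ler01.
Qed.

Lemma bal_bnd a :
  exists2 r : R, 0 < r & - (r *: (1 : A)) <= a /\ a <= r *: (1 : A).
Proof.
have [r r0 ar] := bal_ub a; have [s s0 as_] := bal_ub (- a).
exists (r + s); first exact: addr_gt0.
split; last by apply: (le_trans ar); rewrite lalg_lerZr ?bal_ler01 ?lerDl ?ltW.
rewrite -lalg_lerN2 opprK; apply: (le_trans as_).
by rewrite lalg_lerZr ?bal_ler01// lerDr ltW.
Qed.

Lemma bal_le_archi a b c : (forall r, 0 < r -> a <= b + r *: c) -> a <= b.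
Proof.
move=> h; rewrite -lalg_subr_le0.
(* Taking [r = 1/n] bounds the positive multiples of [a - b] by [c]; the join with 0 covers the
   multiple by 0. *)
apply: (@bal_archimedean _ _ _ (Order.join c 0)).
move=> [|n]; first by rewrite mulr0n leUr.
have n0 : 0 < n.+1%:R :> R by [].
have := h n.+1%:R^-1; rewrite invr_gt0 => /(_ n0).
rewrite addrC -lalg_lerBlDr => /(lalg_lerZl (ltW n0)).
rewrite scalerA mulfV ?gt_eqF// scale1r scaler_nat => /le_trans; apply.
exact: leUl.
Qed.

(** If [a <= r] and [b <= s], then [a * b] is below both [s a] and [r b], so that [a * b] divided by
    [r + s] lies below [a /\ b]. *)
Lemma lalg_disjoint_mul a b :
  0 <= a -> 0 <= b -> Order.meet a b <= 0 -> a * b = 0.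
Proof.
move=> a0 b0 ab; apply: le_anti; rewrite lalg_mulr_ge0// andbT.
have [r r0 ar] := bal_ub a; have [s s0 bs] := bal_ub b.
have k0 : 0 < r + s by exact: addr_gt0.
have H : (r + s)^-1 *: (a * b) <= 0.
  apply: le_trans ab; rewrite lexI; apply/andP; split.
    have -> : a = (r + s)^-1 *: ((r + s) *: a).
      by rewrite scalerA mulVf ?scale1r ?gt_eqF.
    rewrite lalg_lerZl ?invr_ge0 ?(ltW k0)//.
    rewrite scalerA mulVf ?gt_eqF// scale1r.
    apply: (@le_trans _ _ (a * (s *: (1 : A)))); first exact: lalg_ler_wpM2l.
    by rewrite -lalg_scalerAr mulr1 lalg_lerZr// lerDr ltW.
  have -> : b = (r + s)^-1 *: ((r + s) *: b).
    by rewrite scalerA mulVf ?scale1r ?gt_eqF.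
  rewrite lalg_lerZl ?invr_ge0 ?(ltW k0)//.
  rewrite scalerA mulVf ?gt_eqF// scale1r.
  apply: (@le_trans _ _ ((r *: (1 : A)) * b)); first exact: lalg_ler_wpM2r.
  by rewrite -lalg_scalerAl mul1r lalg_lerZr// lerDl ltW.
have := lalg_lerZl (ltW k0) H.
by rewrite scalerA mulfV ?gt_eqF// scale1r scaler0.
Qed.

Lemma lalg_pos_mul_neg a : lalg_pos a * lalg_neg a = 0.
Proof.
by apply: lalg_disjoint_mul;
  rewrite ?lalg_pos_ge0 ?lalg_neg_ge0// lalg_pos_meet_neg.
Qed.

Lemma lalg_neg_mul_pos a : lalg_neg a * lalg_pos a = 0.
Proof.
by apply: lalg_disjoint_mul;
  rewrite ?lalg_pos_ge0 ?lalg_neg_ge0// meetC lalg_pos_meet_neg.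
Qed.

(** The mixed products of the positive and negative parts vanish, which leaves a sum of two squares
    of nonnegative elements. *)
Lemma lalg_sqr_ge0 a : 0 <= a * a.
Proof.
rewrite {1 2}(lalg_posBneg a) mulrBl !mulrBr lalg_pos_mul_neg lalg_neg_mul_pos.
rewrite subr0 sub0r opprK.
by rewrite lalg_addr_ge0// lalg_mulr_ge0 ?lalg_pos_ge0 ?lalg_neg_ge0.
Qed.

End balType_theory.

(** * Algebras of functions with pointwise operations *)

Section subpower.
Variables (R : realType) (I : Type) (L : balType R).

(* Closure of a set of functions [I -> L] under the pointwise operations; it
   serves with [L] the reals for C*(X) and B(X), and with [I = bool] for kernel
   pairs. *)
Record lalg_closed (P : set (I -> L)) : Prop := LalgClosed {
  lclosed1 : P (fun=> 1);
  lclosedD : forall f g, P f -> P g -> P (fun i => f i + g i);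
  lclosedM : forall f g, P f -> P g -> P (fun i => f i * g i);
  lclosedZ : forall r f, P f -> P (fun i => r *: f i);
  lclosed_meet : forall f g, P f -> P g -> P (fun i => Order.meet (f i) (g i));
  lclosed_join : forall f g, P f -> P g -> P (fun i => Order.join (f i) (g i));
  lclosed_bounded : forall f, P f -> exists n : nat, forall i, f i <= n%:R }.

Variables (P : set (I -> L)) (cP : lalg_closed P).

(** The closure proof is a parameter of the type, so that the structures declared on the type below
    can refer to it. *)
Definition subpower of lalg_closed P : Type := {f : I -> L | P f}.

Implicit Types f g h : subpower cP.

Lemma subpower_ext f g : sval f =1 sval g -> f = g.
Proof.
move: f g => [f Pf] [g Pg] /= /funext fg.
by case: _ / fg Pg => Pg; congr exist; exact: Prop_irrelevance.
Qed.

Definition spow_add f g : subpower cP :=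
  exist _ _ (lclosedD cP (svalP f) (svalP g)).
Definition spow_mul f g : subpower cP :=
  exist _ _ (lclosedM cP (svalP f) (svalP g)).
Definition spow_scale (r : R) f : subpower cP :=
  exist _ _ (lclosedZ cP r (svalP f)).
Definition spow_one : subpower cP := exist _ _ (lclosed1 cP).
Definition spow_meet f g : subpower cP :=
  exist _ _ (lclosed_meet cP (svalP f) (svalP g)).
Definition spow_join f g : subpower cP :=
  exist _ _ (lclosed_join cP (svalP f) (svalP g)).
Definition spow_le f g : bool := `[< forall i, sval f i <= sval g i >].

HB.instance Definition _ := gen_eqMixin (subpower cP).
HB.instance Definition _ := gen_choiceMixin (subpower cP).

Fact spow_addA : associative spow_add.
Proof. by move=> f g h; apply: subpower_ext => i; exact: addrA. Qed.
Fact spow_addC : commutative spow_add.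
Proof. by move=> f g; apply: subpower_ext => i; exact: addrC. Qed.
(** Zero and opposites are obtained by scaling, as [0 *: 1] and [-1 *: f]. *)
Fact spow_add0 : left_id (spow_scale 0 spow_one) spow_add.
Proof. by move=> f; apply: subpower_ext => i /=; rewrite scale0r add0r. Qed.
Fact spow_addN :
  left_inverse (spow_scale 0 spow_one) (spow_scale (-1)) spow_add.
Proof.
by move=> f; apply: subpower_ext => i /=; rewrite scaleN1r addNr scale0r.
Qed.

HB.instance Definition _ := GRing.isZmodule.Build (subpower cP)
  spow_addA spow_addC spow_add0 spow_addN.

Fact spow_mulA : associative spow_mul.
Proof. by move=> f g h; apply: subpower_ext => i; exact: mulrA. Qed.
Fact spow_mul1 : left_id spow_one spow_mul.
Proof. by move=> f; apply: subpower_ext => i; exact: mul1r. Qed.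
Fact spow_mulr1 : right_id spow_one spow_mul.
Proof. by move=> f; apply: subpower_ext => i; exact: mulr1. Qed.
Fact spow_mulDl : left_distributive spow_mul (@GRing.add (subpower cP)).
Proof. by move=> f g h; apply: subpower_ext => i; exact: mulrDl. Qed.
Fact spow_mulDr : right_distributive spow_mul (@GRing.add (subpower cP)).
Proof. by move=> f g h; apply: subpower_ext => i; exact: mulrDr. Qed.

HB.instance Definition _ := GRing.Zmodule_isPzRing.Build (subpower cP)
  spow_mulA spow_mul1 spow_mulr1 spow_mulDl spow_mulDr.

Lemma spow_val0 i : sval (0 : subpower cP) i = 0.
Proof. exact: scale0r. Qed.

Definition subpower_lalgebra : lalgebra R.
Proof.
apply: (@LAlgebra R (subpower cP) spow_le spow_meet spow_join spow_scale).
- by move=> f; apply/asboolP => i.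
- move=> f g /andP[/asboolP fg /asboolP gf]; apply: subpower_ext => i.
  by apply: le_anti; rewrite fg gf.
- move=> f g h /asboolP gf /asboolP fh; apply/asboolP => i.
  exact: le_trans (gf i) (fh i).
- move=> f g h; apply/asboolP/andP => [H|[/asboolP fg /asboolP fh] i].
    by split; apply/asboolP => i; have := H i; rewrite lexI => /andP[].
  by rewrite lexI fg fh.
- move=> f g h; apply/asboolP/andP => [H|[/asboolP fg /asboolP fh] i].
    by split; apply/asboolP => i; have := H i; rewrite leUx => /andP[].
  by rewrite leUx fg fh.
- by move=> f g h /asboolP fg; apply/asboolP => i; apply: lalg_leD; exact: fg.
- move=> f g /asboolP f0 /asboolP g0; apply/asboolP => i.
  by have := f0 i; have := g0 i; rewrite !spow_val0 => ? ?;
    exact: lalg_mulr_ge0.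
- by move=> r s f; apply: subpower_ext => i; exact: scalerA.
- by move=> f; apply: subpower_ext => i; exact: scale1r.
- by move=> r f g; apply: subpower_ext => i; exact: scalerDr.
- by move=> f r s; apply: subpower_ext => i; exact: scalerDl.
- by move=> r f g; apply: subpower_ext => i; exact: lalg_scalerAl.
- by move=> r f g; apply: subpower_ext => i; exact: lalg_scalerAr.
- move=> r f r0 /asboolP f0; apply/asboolP => i; have := f0 i.
  by rewrite !spow_val0 => fi; exact: lalg_scaler_ge0.
Defined.

Lemma spow_val_natmul (f : subpower_lalgebra) n i :
  sval (f *+ n) i = sval f i *+ n.
Proof.
by elim: n => [|n IH]; rewrite ?mulr0n ?spow_val0// !mulrSr -IH.
Qed.

Lemma spow_leP (f g : subpower_lalgebra) :
  reflect (forall i, sval f i <= sval g i) (f <= g).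
Proof. exact: asboolP. Qed.

Definition subpower_balType : balType R.
Proof.
apply: (@BalType R subpower_lalgebra).
- move=> f; have [n fn] := lclosed_bounded cP (svalP f); exists n.
  by apply/spow_leP => i; rewrite spow_val_natmul; exact: fn.
- move=> f g fg; apply/spow_leP => i; rewrite spow_val0.
  apply: (@bal_archimedean _ _ _ (sval g i)) => n.
  by rewrite -spow_val_natmul; exact/spow_leP/fg.
Defined.

End subpower.

(** * Points of a basic algebra *)

Section idempotents.
Context {R : realType} {B : balType R}.
Implicit Types (a b e f w : B) (r s : R).

Lemma idem_ge0 e : idem e -> 0 <= e.
Proof. by move=> <-; exact: lalg_sqr_ge0. Qed.

Lemma idem_compl e : idem e -> idem (1 - e).
Proof.
by move=> ee; rewrite /idem mulrBl mul1r mulrBr mulr1 ee subrr subr0.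
Qed.

Lemma idem_le1 e : idem e -> e <= 1.
Proof. by move=> /idem_compl/idem_ge0; rewrite lalg_subr_ge0. Qed.

(** For [0 <= b <= r] the product lies between 0 and [r e (1 - e) = 0]; the general case splits [b]
    into its positive and negative parts. *)
Lemma idem_orthogonal e b : idem e -> e * b * (1 - e) = 0.
Proof.
move=> ee; have e0 := idem_ge0 ee; have c0 := idem_ge0 (idem_compl ee).
wlog b0 : b / 0 <= b => [H|].
  rewrite (lalg_posBneg b) (mulrBr e) mulrBl.
  by rewrite (H _ (lalg_pos_ge0 _)) (H _ (lalg_neg_ge0 _)) subrr.
apply: le_anti; rewrite !lalg_mulr_ge0// andbT.
have [r _ br] := bal_ub b.
apply: (@le_trans _ _ (e * (r *: (1 : B)) * (1 - e))).
  by rewrite lalg_ler_wpM2r// lalg_ler_wpM2l.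
by rewrite -lalg_scalerAr mulr1 -lalg_scalerAl mulrBr mulr1 ee subrr scaler0.
Qed.

(** Multiplication is not assumed commutative. Orthogonality for [e] and for [1 - e] shows that both
    sides equal [e b e]. *)
Lemma idem_comm e b : idem e -> e * b = b * e.
Proof.
move=> ee; have /eqP := idem_orthogonal b ee.
rewrite mulrBr mulr1 subr_eq0 => /eqP ->.
have /eqP := idem_orthogonal b (idem_compl ee).
by rewrite subKr mulrBl mul1r mulrBl subr_eq0 => /eqP ->.
Qed.

Lemma idemM e f : idem e -> idem f -> idem (e * f).
Proof.
by move=> ee ff; rewrite /idem -mulrA (mulrA f) -(idem_comm f ee) -mulrA ff
  mulrA ee.
Qed.

(* The witness is the join of all [x] in [0, 1] that are disjoint from the
   negative part of [w]. *)
Lemma comparing_idem w : dedekind_complete B ->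
  exists f, [/\ idem f, 0 <= f * w & (1 - f) * w <= 0].
Proof.
move=> dcB; pose v := lalg_neg w.
have v0 : 0 <= v by exact: lalg_neg_ge0.
pose S := [set x : B | [/\ 0 <= x, x <= 1 & Order.meet x v <= 0]].
have S0 : S 0 by split; rewrite ?lexx ?bal_ler01 ?leIl.
have [f [fub flub]] : supremums S !=set0.
  by apply: dcB; split; [exists 0|exists 1 => x []].
have f0 : 0 <= f by exact: fub.
have f1 : f <= 1 by apply: flub => x [].
(* The join of S is still disjoint from v: for [x] in S, [x + v] is at most [x \/ v], so
   [f \/ v - v] is an upper bound of S. *)
have fv : Order.meet f v <= 0.
  suff : f <= Order.join f v - v.
    by rewrite lalg_lerBrDr -lalg_join_meet -[leRHS]addr0 lalg_lerD2l.
  apply: flub => x Sx; have [x0 x1 xv] := Sx.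
  rewrite lalg_lerBrDr -lalg_join_meet -[Order.join f v]addr0.
  apply: lalg_lerD => //; rewrite leUx leUr andbT.
  by apply: le_trans (fub _ Sx) (leUl _ _).
(* Adding [g = f /\ (1 - f)] to a member of S gives a member of S, so [f - g] is an upper bound of
   S. Disjointness of [f] and [1 - f] then makes [f] idempotent. *)
have fc : Order.meet f (1 - f) <= 0.
  set g := Order.meet _ _.
  have g0 : 0 <= g by rewrite lexI f0 lalg_subr_ge0.
  suff : f <= f - g by rewrite lalg_lerBrDr -[leRHS]addr0 lalg_lerD2l.
  apply: flub => x Sx; have [x0 x1 xv] := Sx.
  rewrite lalg_lerBrDr; apply/fub; split.
  - exact: lalg_addr_ge0.
  - rewrite -[1](subrK f) addrC; apply: lalg_lerD; first exact: leIr.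
    exact: fub.
  - apply: lalg_meet_addl => //; apply: le_trans fv.
    by rewrite leI2 ?leIl.
have fi : idem f.
  have := lalg_disjoint_mul f0 _ fc; rewrite lalg_subr_ge0 => /(_ f1).
  by rewrite mulrBr mulr1 => /eqP; rewrite subr_eq0 => /eqP.
have c0 : 0 <= 1 - f by rewrite lalg_subr_ge0.
exists f; split=> //.
  rewrite (lalg_posBneg w) mulrBr (lalg_disjoint_mul f0 v0 fv) subr0.
  by rewrite lalg_mulr_ge0 ?lalg_pos_ge0.
have [r r0 wr] := bal_ub (lalg_pos w).
have r1 : 0 < 1 + r by rewrite addr_gt0.
(* The positive part of [w], scaled below 1, belongs to S. Hence it is below a multiple of [f] and
   is annihilated by [1 - f]. *)
have Sw : S ((1 + r)^-1 *: lalg_pos w).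
  split.
  - by rewrite lalg_scaler_ge0 ?lalg_pos_ge0// invr_ge0 ltW.
  - have -> : 1 = (1 + r)^-1 *: ((1 + r) *: (1 : B)) :> B.
      by rewrite scalerA mulVf ?scale1r ?gt_eqF.
    rewrite lalg_lerZl ?invr_ge0 ?(ltW r1)//; apply: (le_trans wr).
    by rewrite lalg_lerZr ?bal_ler01// lerDr.
  - rewrite -(lalg_pos_meet_neg w) leI2//.
    rewrite -[leRHS]scale1r lalg_lerZr ?lalg_pos_ge0//.
    by rewrite invf_le1// lerDl ltW.
have cw : (1 - f) * lalg_pos w <= 0.
  have := lalg_ler_wpM2l c0 (fub _ Sw).
  rewrite [(1 - f) * f]mulrBl mul1r fi subrr.
  rewrite -lalg_scalerAr => /(lalg_lerZl (ltW r1)).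
  by rewrite scalerA mulfV ?gt_eqF// scale1r scaler0.
rewrite (lalg_posBneg w) mulrBr lalg_lerBlDr add0r; apply: (le_trans cw).
by rewrite lalg_mulr_ge0 ?lalg_neg_ge0.
Qed.

Lemma idem_atom_scalerI e r s : idem_atom e -> r *: e = s *: e -> r = s.
Proof.
move=> [_ e0 _] /eqP; rewrite -subr_eq0 -scalerBl => /eqP rse.
apply/eqP/negPn/negP; rewrite -subr_eq0 => rs; apply: e0.
by rewrite -[e]scale1r -(mulVf rs) -scalerA rse scaler0.
Qed.

Lemma idem_atom_lerZ e r s : idem_atom e -> r *: e <= s *: e -> r <= s.
Proof.
move=> ae; have [ee _ _] := ae; rewrite leNgt => rse; apply/negP => sr.
have rs : r *: e = s *: e.
  by apply: le_anti; rewrite rse lalg_lerZr ?(ltW sr)// idem_ge0.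
by move: sr; rewrite (idem_atom_scalerI ae rs) ltxx.
Qed.

(** For [f] comparing [w] with 0, the idempotent [f e] lies below the atom [e], so it is 0 or [e];
    accordingly [w e] is [(1 - f) w e] or [f w e]. *)
Lemma idem_atom_total e w : dedekind_complete B -> idem_atom e ->
  0 <= w * e \/ w * e <= 0.
Proof.
move=> dcB [ee e0 atom]; have ege0 := idem_ge0 ee.
have [f [ff fw cw]] := comparing_idem w dcB.
have fe1 : idem_le (f * e) e by rewrite /idem_le -mulrA ee.
have [fe|fe] := atom _ (idemM ff ee) fe1.
- right; have -> : w * e = (1 - f) * w * e.
    by rewrite -[RHS]mulrA -(idem_comm w ee) mulrA mulrBl mul1r fe subr0.
  by rewrite -(mul0r e) lalg_ler_wpM2r.
- left; have -> : w * e = f * w * e.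
    by rewrite -[RHS]mulrA -(idem_comm w ee) mulrA fe.
  by rewrite lalg_mulr_ge0.
Qed.

(** The scalar is the supremum of the [s] with [s e <= b e]. Totality at the atom gives
    [b e <= (r + d) e] for every [d > 0], and the archimedean property removes [d]. *)
Lemma idem_atom_scalar e b : dedekind_complete B -> idem_atom e ->
  exists r, b * e = r *: e.
Proof.
move=> dcB ae; have [ee e0 _] := ae; have ege0 := idem_ge0 ee.
have [k k0 [kb bk]] := bal_bnd b.
pose S : set R := [set s | s *: e <= b * e].
have Sk : S (- k).
  rewrite /S/= scaleNr -{1}[e]mul1r lalg_scalerAl -mulNr.
  exact: lalg_ler_wpM2r.
have Sub : ubound S k.
  move=> s /= sb; apply: (idem_atom_lerZ ae); apply: (le_trans sb).
  by rewrite -{2}[e]mul1r lalg_scalerAl lalg_ler_wpM2r.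
have hS : has_sup S by split; [exists (- k)|exists k].
exists (sup S); apply: le_anti; apply/andP; split.
  apply: (@bal_le_archi _ _ _ _ e) => d d0; rewrite -scalerDl.
  have [|] := idem_atom_total (b - (sup S + d) *: (1 : B)) dcB ae.
    rewrite mulrBl lalg_subr_ge0 -lalg_scalerAl mul1r => H.
    have : sup S + d <= sup S by exact: (ub_le_sup hS.2).
    by rewrite gerDl leNgt d0.
  by rewrite mulrBl lalg_subr_le0 -lalg_scalerAl mul1r.
apply: (@bal_le_archi _ _ _ _ e) => d d0.
rewrite -lalg_lerBlDr -scalerBl.
have [s Ss sd] := sup_adherent d0 hS.
by apply: le_trans Ss; rewrite lalg_lerZr// ltW.
Qed.

End idempotents.

(** * Points as normal real-valued homomorphisms *)

Section points.
Context {R : realType}.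

Definition point (B : balType R) : Type :=
  {p : balHom B (real_balType R) | normal_hom p}.

(* The strict order that [real_balType R] gets as an [lalgebra] is not convertible
   to that of [R], hence the explicit return type [R]. *)
Definition pev (B : balType R) (p : point B) (b : B) : R := sval p b.

Section point_theory.
Variable B : balType R.
Implicit Types (p q : point B) (a b e : B) (r : R).

Lemma pevD p : {morph pev p : a b / a + b}.
Proof. exact: (balHomD (sval p)). Qed.

Lemma pevM p : {morph pev p : a b / a * b}.
Proof. exact: (balHomM (sval p)). Qed.

Lemma pev1 p : pev p 1 = 1.
Proof. exact: (balHom1 (sval p)). Qed.

Lemma pevZ p r a : pev p (r *: a) = r * pev p a.
Proof. exact: (balHomZ (sval p)). Qed.

Lemma pev_meet p a b : pev p (Order.meet a b) = Num.min (pev p a) (pev p b).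
Proof. exact: (balHom_meet (sval p)). Qed.

Lemma pev_join p a b : pev p (Order.join a b) = Num.max (pev p a) (pev p b).
Proof. exact: (balHom_join (sval p)). Qed.

Lemma pev0 p : pev p 0 = 0.
Proof. by rewrite -(scale0r 0) pevZ mul0r. Qed.

Lemma pevN p a : pev p (- a) = - pev p a.
Proof. by rewrite -scaleN1r pevZ mulN1r. Qed.

Lemma pevB p a b : pev p (a - b) = pev p a - pev p b.
Proof. by rewrite pevD pevN. Qed.

Lemma pevZ1 p r : pev p (r *: (1 : B)) = r.
Proof. by rewrite pevZ pev1 mulr1. Qed.

Lemma pev_le p a b : a <= b -> pev p a <= pev p b.
Proof. by rewrite leEmeet => /eqP <-; rewrite pev_meet ge_min lexx orbT. Qed.

Lemma pev_bounded b : exists M, forall p, `|pev p b| <= M.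
Proof.
have [r _ [rb br]] := bal_bnd b; exists r => p.
have := pev_le p rb; have := pev_le p br.
by rewrite pevN pevZ1 ler_norml => -> ->.
Qed.

Lemma pev_sup p (S : set B) b r : supremums S b ->
  (forall s, S s -> pev p s <= r) -> pev p b <= r.
Proof.
move=> /(svalP p)[_ H] Sr; apply: H => _ [s Ss <-]; exact: Sr.
Qed.

Lemma supremums_opp (S : set B) b :
  infimums S b -> supremums [set - s | s in S] (- b).
Proof.
move=> [lb glb]; split=> [_ [s Ss <-]|c cub]; first by rewrite lalg_lerN2 lb.
rewrite -lalg_lerN2 opprK; apply: glb => s Ss.
by rewrite -lalg_lerN2 opprK; apply: cub; exists s.
Qed.

Lemma pev_inf p (S : set B) b r : infimums S b ->
  (forall s, S s -> r <= pev p s) -> r <= pev p b.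
Proof.
move=> /supremums_opp Sb Sr; rewrite -lerN2 -pevN; apply: (pev_sup Sb).
by move=> _ [s Ss <-]; rewrite pevN lerN2 Sr.
Qed.

Lemma point_ext p q : pev p =1 pev q -> p = q.
Proof.
move: p q => [p pn] [q qn] pq; have {pq}pq : p = q by apply/balHom_eq/funext.
by case: _ / pq qn => qn; congr exist; exact: Prop_irrelevance.
Qed.

End point_theory.

Section basic.
Variable B : balType R.
Hypothesis bB : basic_algebra B.
Implicit Types (p q : point B) (a b e : B) (r : R).

(** The coefficient [f b] of [b e] along [e] is unique, so every algebraic identity for [f] is
    checked after multiplication by [e]. *)
Lemma idem_atom_point e : idem_atom e ->
  exists p, pev p e = 1 /\ forall b, b * e = pev p b *: e.
Proof.
move=> ae; have [ee e0 _] := ae; have ege0 := idem_ge0 ee.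
pose f b : R := sval (cid (idem_atom_scalar b bB.1 ae)).
have fE b : b * e = f b *: e by exact: svalP (cid (idem_atom_scalar b bB.1 ae)).
have fU b r : b * e = r *: e -> f b = r.
  by rewrite fE => /idem_atom_scalerI; exact.
have fD : {morph f : a b / a + b}.
  by move=> a b; apply: fU; rewrite mulrDl !fE scalerDl.
have fM : {morph f : a b / a * b}.
  move=> a b; apply: fU.
  by rewrite -mulrA (fE b) -lalg_scalerAr fE scalerA mulrC.
have f1 : f 1 = 1 by apply: fU; rewrite mul1r scale1r.
have fZ r a : f (r *: a) = r * f a.
  by apply: fU; rewrite -lalg_scalerAl fE scalerA.
have f_le : {homo f : a b / a <= b}.
  move=> a b ab; apply: (idem_atom_lerZ ae); rewrite -!fE.
  exact: lalg_ler_wpM2r.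
have f0 : f 0 = 0 by rewrite -(scale0r 0) fZ mul0r.
(* The values of [f] at the two parts of [a] are nonnegative reals with product 0, so one of them
   vanishes. Joins and meets are recovered from positive parts. *)
have fpos a : f (lalg_pos a) = Num.max (f a) 0.
  have := congr1 f (lalg_posBneg a); rewrite fD -scaleN1r fZ mulN1r => fa.
  have := congr1 f (lalg_pos_mul_neg a); rewrite fM f0 => /eqP.
  have pge0 : 0 <= f (lalg_pos a) by rewrite -f0 f_le// lalg_pos_ge0.
  have nge0 : 0 <= f (lalg_neg a) by rewrite -f0 f_le// lalg_neg_ge0.
  rewrite mulf_eq0 => /orP[] /eqP h; rewrite h in fa *.
    by rewrite fa max_r// sub0r oppr_le0.
  by rewrite fa subr0 max_l.
have fN a : f (- a) = - f a by rewrite -scaleN1r fZ mulN1r.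
have f_join : {morph f : a b / Order.join a b >-> Num.max a b}.
  move=> a b; have -> : Order.join a b = lalg_pos (a - b) + b.
    by rewrite lalg_joinDr subrK add0r.
  by rewrite fD fpos fD fN addr_maxl subrK add0r.
have f_meet : {morph f : a b / Order.meet a b >-> Num.min a b}.
  move=> a b; have -> : Order.meet a b = - Order.join (- a) (- b).
    by rewrite lalg_opp_join !opprK.
  by rewrite fN f_join !fN oppr_max !opprK.
pose h : balHom B (real_balType R) := @BalHom R B (real_balType R) f
  fD fM f1 fZ f_meet f_join.
have hn : normal_hom h.
  move=> S b [ub lub]; split=> [_ [s Ss <-]|r rub].
    exact: f_le (ub _ Ss).
  have c0 : 0 <= 1 - e by exact/idem_ge0/idem_compl.
  (* If [r] bounds [f] on S, changing [b] to [r] on the atom keeps an upper bound of S; multiplying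
     by [e] then yields [f b <= r]. *)
  have : b <= b * (1 - e) + (r : R) *: e.
    apply: lub => s Ss; have -> : s = s * (1 - e) + s * e.
      by rewrite -mulrDr subrK mulr1.
    apply: lalg_lerD; first exact: lalg_ler_wpM2r (ub _ Ss).
    by rewrite fE lalg_lerZr//; apply: rub; exists s.
  move=> /(lalg_ler_wpM2r ege0).
  rewrite mulrDl -mulrA mulrBl mul1r ee subrr mulr0 add0r.
  by rewrite -lalg_scalerAl ee fE => /idem_atom_lerZ; exact.
exists (exist _ h hn); split; last by [].
by apply: fU; rewrite ee scale1r.
Qed.

(** By the archimedean property [b <= d] already fails for some real [d > 0]. The idempotent on
    which [b - d] is nonnegative is then nonzero, and [b] is at least [d] at any atom below it. In
    this way the points determine the order. *)
Lemma idem_atom_gt0 b : ~ b <= 0 ->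
  exists e p, [/\ idem_atom e, pev p e = 1 & 0 < pev p b].
Proof.
move=> b0; have [d d0 bd] : exists2 d : R, 0 < d & ~ b <= d *: (1 : B).
  apply/not_exists2P => H; apply: b0; apply: (@bal_le_archi _ _ _ _ 1) => d d0.
  by have [//|] := H d; rewrite add0r => /contrapT.
have [f [ff fw cw]] := comparing_idem (b - d *: (1 : B)) bB.1.
have f0 : f <> 0.
  by move=> f0; move: cw; rewrite f0 subr0 mul1r lalg_subr_le0.
have [e ae ef] := bB.2 f ff f0; have [ee _ _] := ae.
have [p [pe pE]] := idem_atom_point ae; exists e, p; split=> //.
apply: (lt_le_trans d0); rewrite -(pevZ1 p d) -subr_ge0 -pevB.
have := lalg_ler_wpM2l (idem_ge0 ee) fw; rewrite mulr0 mulrA ef => ew.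
by have := pev_le p ew; rewrite pev0 pevM pe mul1r.
Qed.

Lemma point_leP a b : (forall p, pev p a <= pev p b) -> a <= b.
Proof.
move=> H; rewrite -lalg_subr_le0; apply: contrapT.
by move=> /idem_atom_gt0 [e [p [_ _]]]; rewrite pevB subr_gt0 ltNge H.
Qed.

Lemma point_inj a b : (forall p, pev p a = pev p b) -> a = b.
Proof. by move=> H; apply: le_anti; rewrite !point_leP// => p; rewrite H. Qed.

(** The join of all atoms is 1, so a normal [p] is positive on some atom [e], where it takes the
    value 1. Applying [p] to [b e] identifies [p b] with the coefficient of [b] along [e]. *)
Lemma point_atom p :
  exists e, [/\ pev p e = 1, 0 <= e, e <= 1 & forall b, b * e = pev p b *: e].
Proof.
have sup1 : supremums [set e : B | idem_atom e] 1.
  split=> [e [ee _ _]|u ub]; first exact: idem_le1.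
  rewrite -lalg_subr_le0; apply: contrapT => /idem_atom_gt0 [e [q [ae qe]]].
  by rewrite pevB pev1 -qe subr_gt0 ltNge pev_le// ub.
have [e ae pe] : exists2 e, idem_atom e & 0 < pev p e.
  apply: contrapT => H; have := pev_sup (p := p) (r := 0) sup1.
  rewrite pev1 ler10 => /(_ _)/negP; apply=> // e ae.
  by rewrite leNgt; apply/negP => pe; apply: H; exists e.
have [ee _ _] := ae; have pe1 : pev p e = 1.
  have := congr1 (pev p) ee; rewrite pevM -[RHS]mulr1.
  by apply: mulfI; rewrite gt_eqF.
have [q [qe qE]] := idem_atom_point ae.
exists e; split; rewrite ?idem_ge0 ?idem_le1// => b; rewrite qE; congr (_ *: _).
by have := congr1 (pev p) (qE b); rewrite pevM pevZ pe1 !mulr1.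
Qed.

Lemma point_realize (g : point B -> R) M : (forall p, `|g p| <= M) ->
  exists b, forall p, pev p b = g p.
Proof.
move=> gM; pose e p := sval (cid (point_atom p)).
have eP p : [/\ pev p (e p) = 1, 0 <= e p, e p <= 1 &
  forall b, b * e p = pev p b *: e p] by exact: svalP (cid (point_atom p)).
have g0 p : 0 <= g p + M by have := gM p; rewrite ler_norml lerNl -subr_ge0
  opprK addrC => /andP[].
(* The function is built as a join of multiples of atoms. The shift by M makes the coefficients
   nonnegative, and the member 0 keeps S nonempty when there are no points. *)
pose S := [set x : B | x = 0 \/ exists p, x = (g p + M) *: e p].
(* A point [q] that does not vanish on the atom of [p] equals [p]: apply [q] to
   [b * e p = pev p b *: e p] and cancel. *)
have pe q p : pev q ((g p + M) *: e p) <= g q + M.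
  rewrite pevZ; have [_ e0 _ pE] := eP p.
  have [->|qe] := eqVneq (pev q (e p)) 0; first by rewrite mulr0.
  suff qp : q = p by rewrite -qp; have [-> _ _ _] := eP q; rewrite mulr1.
  apply: point_ext => b; have := congr1 (pev q) (pE b).
  by rewrite pevM pevZ; exact: mulIf.
have [b Sb] : supremums S !=set0.
  apply: bB.1; split; first by exists 0; left.
  exists ((M + M) *: (1 : B)) => x Sx; apply: point_leP => q; rewrite pevZ1.
  have gqM : g q + M <= M + M.
    by rewrite lerD2r; apply: le_trans (gM q); exact: ler_norm.
  case: Sx => [->|[p ->]]; first by rewrite pev0 (le_trans (g0 q)).
  exact: le_trans (pe q p) gqM.
exists (b - M *: (1 : B)) => q; rewrite pevB pevZ1; apply/eqP.
rewrite subr_eq eq_le; apply/andP; split.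
  by apply: (pev_sup Sb) => s [->|[p ->]]; rewrite ?pev0.
have : (g q + M) *: e q <= b by apply: Sb.1; right; exists q.
by move=> /(pev_le q); rewrite pevZ; have [-> _ _ _] := eP q; rewrite mulr1.
Qed.

Lemma supremums_point (S : set B) b : (forall s, S s -> s <= b) ->
  (forall p r, (forall s, S s -> pev p s <= r) -> pev p b <= r) ->
  supremums S b.
Proof.
move=> ub H; split=> // u uub; apply: point_leP => p; apply: H => s Ss.
by apply: pev_le; exact: uub.
Qed.

Lemma infimums_point (S : set B) b : (forall s, S s -> b <= s) ->
  (forall p r, (forall s, S s -> r <= pev p s) -> r <= pev p b) ->
  infimums S b.
Proof.
move=> ub H; split=> // u uub; apply: point_leP => p; apply: H => s Ss.
by apply: pev_le; exact: uub.
Qed.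

End basic.
End points.

(** * Algebras of functions *)

Section lnorm.
Context {R : realType} {A : balType R}.
Implicit Types (a : A) (e : R).

Lemma lnorm_lt a e : 0 < e -> lnorm a < e -> Order.join a (- a) <= e *: (1 : A).
Proof.
rewrite /lnorm; set N := [set r : R | _] => e0 Ne.
have upN r : N r -> r <= e -> N e.
  by rewrite /N/= => Nr re; rewrite (le_trans Nr)// lalg_lerZr ?bal_ler01.
have N0 : N !=set0 by have [r _ ar] := bal_ub (Order.join a (- a)); exists r.
by have [r Nr re] := inf_lt N0 Ne; exact: upN Nr (ltW re).
Qed.

Lemma lnorm_le a e :
  0 <= e -> Order.join a (- a) <= e *: (1 : A) -> lnorm a <= e.
Proof.
rewrite /lnorm; set N := [set r : R | _] => e0 Ne.
(* Without a lower bound, as in the zero algebra, [inf] takes the value 0, which is at most [e]. *)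
have [lN|lN] := pselect (has_lbound N); first exact: ge_inf.
by rewrite inf_out// => -[].
Qed.

End lnorm.

Section function_algebras.
Context {R : realType}.

(** The limit inherits every Cauchy estimate with the same [e] and [N]; a Cauchy estimate uniform in
    a parameter therefore gives uniform convergence. *)
Lemma cauchy_limit (u : nat -> R) :
  (forall e, 0 < e -> exists N, forall m n,
    (N <= m)%N -> (N <= n)%N -> `|u m - u n| <= e) ->
  exists l, forall e N, (forall m n,
    (N <= m)%N -> (N <= n)%N -> `|u m - u n| <= e) ->
    forall n, (N <= n)%N -> `|u n - l| <= e.
Proof.
move=> uC; have /R_complete uc : cauchy (u n @[n --> \oo]).
  apply: cauchy_exP => e e0; have [|N uN] := uC (e / 2); first exact: divr_gt0.
  exists (u N); exists N => // n /= Nn; rewrite /ball/=.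
  rewrite (le_lt_trans (uN _ _ (leqnn N) Nn))//.
  by rewrite ltr_pdivrMr// ltr_pMr// ltr1n.
exists (limn u) => e N uN n Nn; apply/ler_addgt0Pr => d d0.
have /cvgrPdist_lt/(_ d d0)[K _ uK] : u n @[n --> \oo] --> limn u by exact: uc.
have := uK (maxn N K); rewrite /= leq_maxr => /(_ isT) h.
rewrite -(subrK (u (maxn N K)) (u n)) -addrA (le_trans (ler_normD _ _))//.
by rewrite lerD ?uN ?leq_maxl// distrC ltW.
Qed.

Definition bounded_function (T : Type) : set (T -> real_balType R) :=
  [set f | exists M : R, forall x, `|f x : R| <= M].

Lemma bounded_function_closed T : lalg_closed (@bounded_function T).
Proof.
split.
- by exists 1 => x; rewrite normr1.
- move=> f g [M fM] [N gN]; exists (M + N) => x.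
  exact: le_trans (ler_normD _ _) (lerD (fM x) (gN x)).
- move=> f g [M fM] [N gN]; exists (M * N) => x.
  by rewrite normrM ler_pM.
- by move=> r f [M fM]; exists (`|r| * M) => x; rewrite normrM ler_wpM2l.
- move=> f g [M fM] [N gN]; exists (Num.max M N) => x.
  by change (`|Num.min (f x : R) (g x)| <= Num.max M N);
    case: (leP (f x : R) (g x)) => _; rewrite le_max ?fM ?gN ?orbT.
- move=> f g [M fM] [N gN]; exists (Num.max M N) => x.
  by change (`|Num.max (f x : R) (g x)| <= Num.max M N);
    case: (leP (f x : R) (g x)) => _; rewrite le_max ?fM ?gN ?orbT.
- move=> f [M fM]; exists (Num.bound `|M|) => x.
  apply: (@le_trans _ R M); first exact: le_trans (ler_norm _) (fM x).
  exact: le_nat_bound.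
Qed.

Definition cont_bounded (X : topologicalType) : set (X -> real_balType R) :=
  [set f | continuous (f : X -> R) /\ bounded_function f].

Lemma cont_bounded_closed X : lalg_closed (@cont_bounded X).
Proof.
have [b1 bD bM bZ bI bU bb] := bounded_function_closed X; split.
- by split=> // x; exact: cvg_cst.
- move=> f g [cf bf] [cg bg]; split; last exact: bD.
  by move=> x; exact: (@cvgD _ R^o _ _ _ _ _ _ _ (cf x) (cg x)).
- move=> f g [cf bf] [cg bg]; split; last exact: bM.
  by move=> x; exact: (cvgM (cf x) (cg x)).
- move=> r f [cf bf]; split; last exact: bZ.
  by move=> x; exact: (cvgM (cvg_cst r) (cf x)).
- move=> f g [cf bf] [cg bg]; split; last exact: bI.
  by move=> x; exact: (continuous_min (cf x) (cg x)).
- move=> f g [cf bf] [cg bg]; split; last exact: bU.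
  by move=> x; exact: (continuous_max (cf x) (cg x)).
- by move=> f [_ /bb].
Qed.

Definition Bfun (T : Type) : balType R :=
  subpower_balType (bounded_function_closed T).

Definition Cfun (X : topologicalType) : balType R :=
  subpower_balType (cont_bounded_closed X).

Definition bval T (f : Bfun T) : T -> R := sval f.
Definition cval X (f : Cfun X) : X -> R := sval f.

Lemma bvalP T (f : Bfun T) : exists M : R, forall x, `|bval f x| <= M.
Proof. exact: svalP f. Qed.

Lemma cvalP X (f : Cfun X) :
  continuous (cval f) /\ exists M : R, forall x, `|cval f x| <= M.
Proof. exact: svalP f. Qed.

Definition toB T (f : T -> R) (bf : exists M : R, forall x, `|f x| <= M) :
  Bfun T := exist _ f bf.

Definition toC (X : topologicalType) (f : X -> R) (cf : continuous f)
  (bf : exists M : R, forall x, `|f x| <= M) : Cfun X := exist _ f (conj cf bf).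

Lemma bval_leP T (f g : Bfun T) :
  reflect (forall x, bval f x <= bval g x) (f <= g).
Proof. exact: spow_leP. Qed.

Lemma cval_leP X (f g : Cfun X) :
  reflect (forall x, cval f x <= cval g x) (f <= g).
Proof. exact: spow_leP. Qed.

Lemma bval_ext T (f g : Bfun T) : bval f =1 bval g -> f = g.
Proof. by move=> fg; apply: subpower_ext => x; exact: fg. Qed.

Lemma cval_ext X (f g : Cfun X) : cval f =1 cval g -> f = g.
Proof. by move=> fg; apply: subpower_ext => x; exact: fg. Qed.

Lemma bval0 T x : bval (0 : Bfun T) x = 0.
Proof. exact: mul0r. Qed.

Lemma cvalN X (f : Cfun X) x : cval (- f) x = - cval f x.
Proof. exact: mulN1r. Qed.

Lemma cvalB X (f g : Cfun X) x : cval (f - g) x = cval f x - cval g x.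
Proof. exact: congr1 (cvalN _ _). Qed.

Lemma cval_cst (X : topologicalType) r (x : X) : cval (r *: (1 : Cfun X)) x = r.
Proof. exact: mulr1. Qed.

Definition CtoB (X : topologicalType) : balHom (Cfun X) (Bfun X).
Proof.
by apply: (@BalHom R (Cfun X) (Bfun X)
  (fun f => exist _ (sval f) (proj2 (svalP f)))) => [? ?|? ?||? ?|? ?|? ?];
  exact: bval_ext.
Defined.

Section precomposition.
Variables (X Y : topologicalType) (h : X -> Y) (hc : continuous h).

Lemma bounded_precomp (f : Y -> R) : (exists M, forall y, `|f y| <= M) ->
  exists M, forall x, `|(f \o h) x| <= M.
Proof. by move=> [M fM]; exists M => x; exact: fM. Qed.

Lemma continuous_precomp (f : Y -> R) : continuous f -> continuous (f \o h).
Proof. by move=> cf x; apply: continuous_comp; [exact: hc|exact: cf]. Qed.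

Definition precompB : balHom (Bfun Y) (Bfun X).
Proof.
by apply: (@BalHom R (Bfun Y) (Bfun X)
  (fun f => toB (bounded_precomp (bvalP f)))) => [? ?|? ?||? ?|? ?|? ?];
  exact: bval_ext.
Defined.

Definition precompC : balHom (Cfun Y) (Cfun X).
Proof.
by apply: (@BalHom R (Cfun Y) (Cfun X)
  (fun f => toC (continuous_precomp (cvalP f).1) (bounded_precomp (cvalP f).2)))
  => [? ?|? ?||? ?|? ?|? ?]; exact: cval_ext.
Defined.

End precomposition.

End function_algebras.

(** * Interpolation of a continuous function between two sequences *)

Section interpolation.
Context {R : realType} {X : topologicalType}.
Implicit Types (F G : nat -> X -> R) (x : X) (c e : R).

Fixpoint run_min F n x : R :=
  if n is m.+1 then Num.min (run_min F m x) (F m.+1 x) else F 0%N x.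

Fixpoint run_max G n x : R :=
  if n is m.+1 then Num.max (run_max G m x) (G m.+1 x) else G 0%N x.

Lemma continuous_distP (f : X -> R) : continuous f <->
  forall x e, 0 < e -> \forall y \near x, `|f x - f y| < e.
Proof.
split=> [cf x e e0|H x]; first by have /cvgrPdist_lt := cf x; exact.
by apply/cvgrPdist_lt => e e0; exact: H.
Qed.

Lemma run_min_continuous F n :
  (forall n, continuous (F n)) -> continuous (run_min F n).
Proof.
move=> cF; elim: n => [|n IH] x; first exact: cF.
exact: (continuous_min (IH x) (cF n.+1 x)).
Qed.

Lemma run_max_continuous G n :
  (forall n, continuous (G n)) -> continuous (run_max G n).
Proof.
move=> cG; elim: n => [|n IH] x; first exact: cG.
exact: (continuous_max (IH x) (cG n.+1 x)).
Qed.

Lemma run_min_le F n x : run_min F n x <= F n x.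
Proof. by case: n => [|n] //=; rewrite ge_min lexx orbT. Qed.

Lemma run_max_ge G n x : G n x <= run_max G n x.
Proof. by case: n => [|n] //=; rewrite le_max lexx orbT. Qed.

Lemma run_min_ge F n x c : (forall n, c <= F n x) -> c <= run_min F n x.
Proof. by move=> cF; elim: n => [|n IH] /=; rewrite ?le_min ?IH ?cF. Qed.

Lemma run_max_le G n x c : (forall n, G n x <= c) -> run_max G n x <= c.
Proof. by move=> cG; elim: n => [|n IH] /=; rewrite ?ge_max ?IH ?cG. Qed.

Lemma run_min_anti F m n x : (m <= n)%N -> run_min F n x <= run_min F m x.
Proof.
elim: n => [|n IH]; first by rewrite leqn0 => /eqP ->.
rewrite leq_eqVlt => /orP[/eqP -> //|]; rewrite ltnS => /IH.
by apply: le_trans; rewrite /= ge_min lexx.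
Qed.

Lemma run_max_mono G m n x : (m <= n)%N -> run_max G m x <= run_max G n x.
Proof.
elim: n => [|n IH]; first by rewrite leqn0 => /eqP ->.
rewrite leq_eqVlt => /orP[/eqP -> //|]; rewrite ltnS => /IH /le_trans; apply.
by rewrite /= le_max lexx.
Qed.

(* With [f_n] the running minima of [F], [g_n] the running maxima of [G], the
   function [sup_n (min f_n g_n)] is also the infimum of [f_0] and of the
   [max f_n.+1 g_n], so that it is both lower and upper semicontinuous. *)
Lemma interpolation F G (M : R) :
  (forall n, continuous (F n)) -> (forall n, continuous (G n)) ->
  (forall n x, G n x <= M) ->
  (forall x e, 0 < e -> exists n, F n x < G n x + e) ->
  exists a : X -> R, [/\ continuous a,
    forall x c, (forall n, c <= F n x) -> c <= a x &
    forall x c, (forall n, G n x <= c) -> a x <= c].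
Proof.
move=> cF cG GM FG; pose f := run_min F; pose g := run_max G.
pose h n x := Num.min (f n x) (g n x).
have hM x : has_sup [set h n x | n in setT].
  split; first by exists (h 0%N x); exists 0%N.
  by exists M => _ [n _ <-]; rewrite ge_min run_max_le ?orbT.
pose a x := sup [set h n x | n in setT].
have ha n x : h n x <= a x by apply: (ub_le_sup (hM x).2); exists n.
have a_lub x c : (forall n, h n x <= c) -> a x <= c.
  by move=> hc; apply: (ge_sup (hM x).1) => _ [n _ <-].
have af0 x : a x <= f 0%N x.
  by apply: a_lub => n; rewrite ge_min run_min_anti.
(* The terms [h m] with [m <= n] lie below [g n], and those with [m > n] below [f n.+1]. *)
have afg n x : a x <= Num.max (f n.+1 x) (g n x).
  apply: a_lub => m; rewrite le_max !ge_min.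
  case: (leqP m n) => mn; first by rewrite [g m x <= g n x]run_max_mono// !orbT.
  by rewrite [f m x <= f n.+1 x]run_min_anti.
exists a; split; last first.
- by move=> x c Gc; apply: a_lub => n; rewrite ge_min run_max_le ?orbT.
- move=> x c cFx; apply/ler_addgt0Pr => e e0; have [n Fn] := FG x e e0.
  rewrite -lerBlDr; apply: le_trans (ha n x); rewrite le_min; apply/andP; split.
    by rewrite lerBlDr (le_trans (run_min_ge n cFx))// lerDl ltW.
  rewrite lerBlDr; apply: le_trans (cFx n) _; apply: (le_trans (ltW Fn)).
  by rewrite lerD2r run_max_ge.
apply/continuous_distP => x e e0.
(* Some continuous [h n], which lies below [a], exceeds [a x - e] at [x]. *)
have lsc : \forall y \near x, a x - e < a y.
  have [_ [n _ <-] hn] := sup_adherent e0 (hM x).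
  have d0 : 0 < h n x - (a x - e) by rewrite subr_gt0.
  have /continuous_distP/(_ x _ d0) : continuous (h n).
    move=> y; apply: (@continuous_min _ _ (f n) (g n)).
      exact: run_min_continuous.
    exact: run_max_continuous.
  apply: filterS => y /(le_lt_trans (ler_norm _)).
  rewrite ltrD2l ltrN2 => /lt_le_trans; apply; exact: ha.
have usc : \forall y \near x, a y < a x + e.
  have [fx|fx] := ltP (f 0%N x) (a x + e).
    have d0 : 0 < a x + e - f 0%N x by rewrite subr_gt0.
    have /continuous_distP/(_ x _ d0) := run_min_continuous (n := 0) cF.
    apply: filterS => y; rewrite distrC => /(le_lt_trans (ler_norm _)).
    by rewrite ltrD2r; exact: le_lt_trans.
  (* Otherwise every [f n x] is at least [a x + e], by induction from [f 0]. As
     [min (f n) (g n) <= a], every [g n x] is then at most [a x], and the gap [e] at [x] contradicts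
     [FG]. *)
  have [n fgx] : exists n, Num.max (f n.+1 x) (g n x) < a x + e.
    apply: contrapT => H.
    have gn n : a x + e <= f n x -> g n x <= a x.
      move=> fn; have := ha n x; rewrite ge_min => /orP[|//].
      by move=> /(le_trans fn); rewrite gerDl leNgt e0.
    have fn n : a x + e <= f n x.
      elim: n => [//|n IH]; rewrite leNgt; apply/negP => fn1; apply: H.
      by exists n; rewrite gt_max fn1 (le_lt_trans (gn n IH))// ltrDl.
    have [n] := FG x e e0; apply/negP; rewrite -leNgt.
    apply: le_trans (le_trans (fn n) (run_min_le F n x)).
    by rewrite lerD2r (le_trans (run_max_ge G n x))// gn.
  have d0 : 0 < a x + e - Num.max (f n.+1 x) (g n x) by rewrite subr_gt0.
  have /continuous_distP/(_ x _ d0) :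
      continuous (fun y => Num.max (f n.+1 y) (g n y)).
    move=> y; apply: (@continuous_max _ _ (f n.+1) (g n)).
      exact: run_min_continuous.
    exact: run_max_continuous.
  apply: filterS => y; rewrite distrC => /(le_lt_trans (ler_norm _)).
  by rewrite ltrD2r; apply: le_lt_trans; exact: afg.
near=> y; rewrite distrC ltr_norml ltrBlDl ltrBrDl; apply/andP; split.
  by near: y.
by near: y.
Unshelve. all: by end_near. Qed.

End interpolation.

(** The [n]-th index is one whose set belongs to the countable subcover and has code [n]. The point
    [x0] provides a default index for the numbers that code nothing. *)
Lemma lindelof_seq (X : topologicalType) (I : Type) (V : I -> set X) (x0 : X) :
  lindelof X -> (forall i, open (V i)) -> (forall x, exists i, V i x) ->
  exists s : nat -> I, forall x, exists n, V (s n) x.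
Proof.
move=> lX oV cV; have [i0 _] := cV x0.
have [W [WV /countable_injP[f finj] Wc]] : exists W : set (set X),
    [/\ W `<=` range V, countable W & \bigcup_(A in W) A = setT].
  apply: lX => [_ [i _ <-] //|]; apply/seteqP; split=> // x _.
  by have [i Vx] := cV x; exists (V i) => //; exists i.
have /choice[s sP] n : exists i,
    (exists2 j, W (V j) & f (V j) = n) -> W (V i) /\ f (V i) = n.
  have [[j Wj fj]|H] := pselect (exists2 j, W (V j) & f (V j) = n).
    by exists j.
  by exists i0.
exists s => x; have [A WA Ax] : (\bigcup_(A in W) A) x by rewrite Wc.
have [i _ Ai] := WV _ WA; exists (f A).
have [|Ws fs] := sP (f A); first by exists i; rewrite Ai.
have -> // : V (s (f A)) = A by apply: finj; rewrite ?inE.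
Qed.

(** * The basic algebra of all bounded functions *)

Section bounded_functions.
Context {R : realType} {T : Type}.
Implicit Types (f b : Bfun (R := R) T) (x y : T) (r : R).

Lemma supremums_bval (S : set (Bfun T)) b : (forall f, S f -> f <= b) ->
  (forall x r, (forall f, S f -> bval f x <= r) -> bval b x <= r) ->
  supremums S b.
Proof.
move=> Sb H; split=> // u Su; apply/bval_leP => x; apply: H => f Sf.
exact/bval_leP/Su.
Qed.

Lemma infimums_bval (S : set (Bfun T)) b : (forall f, S f -> b <= f) ->
  (forall x r, (forall f, S f -> r <= bval f x) -> r <= bval b x) ->
  infimums S b.
Proof.
move=> Sb H; split=> // u Su; apply/bval_leP => x; apply: H => f Sf.
exact/bval_leP/Su.
Qed.

Definition update (f : T -> R) x r y : R := if `[< y = x >] then r else f y.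

Lemma update_eq (f : T -> R) x r : update f x r x = r.
Proof. by rewrite /update asboolT. Qed.

Lemma update_neq (f : T -> R) x r y : y <> x -> update f x r y = f y.
Proof. by move=> yx; rewrite /update asboolF. Qed.

Lemma bounded_update (f : T -> R) x r : (exists M, forall y, `|f y| <= M) ->
  exists M, forall y, `|update f x r y| <= M.
Proof.
move=> [M fM]; exists (Num.max `|r| M) => y.
by rewrite /update; case: ifP => _; rewrite le_max ?lexx ?fM ?orbT.
Qed.

Lemma bounded_cst (M : R) : exists N, forall y : T, `|cst M y| <= N.
Proof. by exists `|M|. Qed.

Definition updateB f x r : Bfun T := toB (bounded_update x r (bvalP f)).
Definition spike (M : R) x r : Bfun T :=
  toB (bounded_update x r (bounded_cst M)).

Definition evalB x : balHom (Bfun T) (real_balType R).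
Proof.
by refine (@BalHom R (Bfun T) (real_balType R) (fun f => bval f x) _ _ _ _ _ _).
Defined.

(* If [u] bounds [f x] for all [f] in [S], then [b] with its value at [x]
   replaced by [u] is still an upper bound of [S]. *)
Lemma evalB_normal x : normal_hom (evalB x).
Proof.
move=> S b [ub lub]; split=> [_ [f Sf <-]|u Su]; first exact/bval_leP/ub.
suff : b <= updateB b x u by move=> /bval_leP/(_ x); rewrite [leRHS]update_eq.
apply: lub => f Sf; apply/bval_leP => y.
have [->|yx] := pselect (y = x).
  by rewrite [leRHS]update_eq; apply: Su; exists f.
by rewrite [leRHS]update_neq//; exact/bval_leP/ub.
Qed.

Definition eval_point x : point (Bfun T) := exist _ (evalB x) (evalB_normal x).

Lemma pev_eval_point x f : pev (eval_point x) f = bval f x.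
Proof. by []. Qed.

Lemma Bfun_dedekind : dedekind_complete (Bfun (R := R) T).
Proof.
move=> S [[f0 Sf0] [u uS]].
pose V x := [set bval f x | f in S].
have V0 x : V x !=set0 by exists (bval f0 x); exists f0.
have Vu x : ubound (V x) (bval u x).
  by move=> _ [f Sf <-]; apply/bval_leP; exact: uS.
have Vh x : has_ubound (V x) by exists (bval u x).
have bb : exists M : R, forall x, `|sup (V x)| <= M.
  have [M fM] := bvalP f0; have [N uN] := bvalP u; exists (Num.max M N) => x.
  rewrite ler_norml lerNl; apply/andP; split.
    rewrite le_max; apply/orP; left; apply: le_trans (fM x).
    rewrite -normrN; apply: le_trans (ler_norm _); rewrite lerN2.
    by apply: (ub_le_sup (Vh x)); exists f0.
  rewrite le_max; apply/orP; right; apply: le_trans (uN x).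
  by apply: le_trans (ler_norm _); exact: (ge_sup (V0 x)).
exists (toB bb); apply: supremums_bval => [f Sf|x r H].
  by apply/bval_leP => x; apply: (ub_le_sup (Vh x)); exists f.
by apply: (ge_sup (V0 x)) => _ [f Sf <-]; exact: H.
Qed.

(** Idempotents take only the values 0 and 1, and the indicator of a single point is an atom. *)
Lemma Bfun_atomic : idempotents_atomic (Bfun (R := R) T).
Proof.
move=> e ee e0.
have [x ex] : exists x, bval e x <> 0.
  apply: contrapT => H; apply: e0; apply: bval_ext => x.
  apply: contrapT => ex; apply: H; exists x => ex0; apply: ex.
  by rewrite ex0 bval0.
have idem01 (f : Bfun (R := R) T) y : idem f -> bval f y = 0 \/ bval f y = 1.
  move=> ff; have := congr1 (fun f => bval f y) (ff : f * f = f).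
  change (bval f y * bval f y = bval f y -> bval f y = 0 \/ bval f y = 1).
  move=> h; have [->|fy] := eqVneq (bval f y) 0; [by left|right].
  by apply: (mulfI fy); rewrite mulr1.
have ex1 : bval e x = 1 by case: (idem01 e x ee).
have mulE (f g : Bfun (R := R) T) y :
  bval (f * g) y = bval f y * bval g y by [].
have sE y : y <> x -> bval (spike 0 x 1) y = 0 by exact: update_neq.
have sx : bval (spike 0 x 1) x = 1 by exact: update_eq.
exists (spike 0 x 1); last first.
  apply: bval_ext => y; rewrite mulE.
  have [->|yx] := pselect (y = x); first by rewrite sx ex1 mulr1.
  by rewrite sE// mul0r.
split.
- apply: bval_ext => y; rewrite mulE.
  have [->|yx] := pselect (y = x); first by rewrite sx mulr1.
  by rewrite sE// mul0r.
- move=> /(congr1 (fun f => bval f x)); rewrite sx bval0 => /eqP.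
  by rewrite oner_eq0.
- move=> f ff fs; have fy y : y <> x -> bval f y = 0.
    by move=> yx; rewrite -fs mulE sE// mulr0.
  have [fx|fx] := idem01 f x ff; [left|right]; apply: bval_ext => y;
    have [->|yx] := pselect (y = x); rewrite ?fx ?sx ?bval0// fy ?sE//.
Qed.

Lemma Bfun_basic : basic_algebra (Bfun (R := R) T).
Proof. by split; [exact: Bfun_dedekind|exact: Bfun_atomic]. Qed.

Lemma dedekind_infimums (S : set (Bfun (R := R) T)) u :
  S !=set0 -> lbound S u -> exists b, infimums S b.
Proof.
move=> [f Sf] Su; have [b [ub lub]] : supremums (lbound S) !=set0.
  by apply: Bfun_dedekind; split; [exists u|exists f => v; exact].
by exists b; split=> // g Sg; apply: lub => v; exact.
Qed.

End bounded_functions.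

(** * The extension of C*(X) into B(X), and (SL) for Lindelof X *)

Section function_extension.
Context {R : realType}.

Lemma CtoB_mono (X : topologicalType) :
  @is_mono (bal R) (Cfun X) (Bfun X) (CtoB X).
Proof.
move=> W g h gh; apply: balHom_eq; apply/funext => w; apply: cval_ext => x.
by have /(congr1 (fun k => bval (bal_fun k w) x)) := gh.
Qed.

(** A function bounded by M is the join over [x] of the functions [d x] that agree with it at [x]
    and equal [- M] elsewhere. Each [d x] is the meet of the continuous functions above it: the
    constant [b x] gives the value at [x], and complete regularity the value at another point. *)
Lemma CtoB_dense (X : cregSpace) : join_meet_dense (CtoB (R := R) X).
Proof.
move=> b; have [M bM] := bvalP b.
have Mb x : 0 <= bval b x + M.
  by have := bM x; rewrite ler_norml -subr_ge0 opprK => /andP[].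
have Mb' x : - M <= bval b x by rewrite -subr_ge0 opprK.
pose d x : Bfun X := spike (- M) x (bval b x).
have dx x : bval (d x) x = bval b x by exact: update_eq.
have dy x y : y <> x -> bval (d x) y = - M by exact: update_neq.
exists (range d); last first.
  apply: supremums_bval => [_ [x _ <-]|x r H]; last first.
    by rewrite -dx; apply: H; exists x.
  apply/bval_leP => y; have [->|yx] := pselect (y = x); first by rewrite dx.
  by rewrite dy.
move=> _ [x _ <-]; exists [set f : Cfun X | d x <= CtoB X f].
apply: infimums_bval => [_ [f df <-] //|y r H].
have [->|yx] := pselect (y = x).
  pose c := bval b x *: (1 : Cfun X).
  have cE z : bval (CtoB X c) z = bval b x by exact: cval_cst.
  have := H (CtoB X c); rewrite dx cE; apply; exists c => //.
  apply/bval_leP => z; rewrite cE.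
  by have [->|zx] := pselect (z = x); rewrite ?dx// dy//; exact: Mb'.
rewrite dy//.
have /(@uniform_separatorP _ R)[g [cg g01 g0 g1]] :
    uniform_separator [set x] [set y].
  apply: creg_regular; last by move=> /esym.
  exact/accessible_closed_set1/hausdorff_accessible/creg_hausdorff.
have gx : g x = 0 by apply: g0; exists x.
have gy : g y = 1 by apply: g1; exists y.
have {}g01 z : 0 <= g z <= 1.
  by have := g01 (g z); rewrite /= in_itv; apply; exists z.
(* This continuous function descends from [b x] at [x] to [- M] at [y] and stays above [- M], so it
   dominates [d x]. *)
pose f z := bval b x - (bval b x + M) * g z.
have cf : continuous f.
  move=> z; apply: (@cvgB _ R^o); first exact: cvg_cst.
  by apply: cvgM; [exact: cvg_cst|exact: cg].
have bf : exists N, forall z, `|f z| <= N.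
  exists (`|bval b x| + (bval b x + M)) => z.
  rewrite (le_trans (ler_normB _ _))// lerD2l.
  have /andP[gz0 gz1] := g01 z.
  by rewrite normrM !ger0_norm// ler_piMr.
have := H (CtoB X (toC cf bf)).
have -> : bval (CtoB X (toC cf bf)) y = - M.
  by rewrite /bval/= /f gy mulr1 opprD addrA subrr sub0r.
apply; exists (toC cf bf) => //; apply/bval_leP => z.
have [->|zx] := pselect (z = x).
  by rewrite dx /bval/= /f gx mulr0 subr0.
rewrite dy// /bval/= /f -subr_ge0 opprK addrAC -{1}[bval b x + M]mulr1 -mulrBr.
by rewrite mulr_ge0// subr_ge0; have /andP[] := g01 z.
Qed.

Lemma normB_le (X : topologicalType) (f : Cfun X) (e : R) :
  reflect (forall x, `|cval f x| <= e)
    (Order.join f (- f) <= e *: (1 : Cfun X)).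
Proof.
apply: (iffP (cval_leP _ _)) => H x; have := H x.
  have -> : cval (Order.join f (- f)) x = Num.max (cval f x) (- cval f x).
    by rewrite -cvalN.
  by rewrite cval_cst ge_max ler_norml lerNl andbC.
have -> : cval (Order.join f (- f)) x = Num.max (cval f x) (- cval f x).
  by rewrite -cvalN.
by rewrite cval_cst ge_max ler_norml lerNl andbC.
Qed.

Lemma Cfun_complete (X : topologicalType) :
  uniformly_complete (Cfun (R := R) X).
Proof.
move=> u uC.
have uC' e : 0 < e -> exists N, forall x m n, (N <= m)%N -> (N <= n)%N ->
    `|cval (u m) x - cval (u n) x| <= e.
  move=> e0; have [N uN] := uC e e0; exists N => x m n Nm Nn.
  by have /(lnorm_lt e0)/normB_le/(_ x) := uN m n Nm Nn; rewrite cvalB.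
have /choice[l lP] x : exists l, forall e N, (forall m n,
    (N <= m)%N -> (N <= n)%N -> `|cval (u m) x - cval (u n) x| <= e) ->
    forall n, (N <= n)%N -> `|cval (u n) x - l| <= e.
  apply: (cauchy_limit (u := fun n => cval (u n) x)) => e /uC'[N uN].
  by exists N; exact: uN.
have lim e : 0 < e ->
    exists N, forall x n, (N <= n)%N -> `|cval (u n) x - l x| <= e.
  by move=> /uC'[N uN]; exists N => x; apply: lP; exact: uN.
have cl : continuous l.
  apply/continuous_distP => x e e0; have e3 : 0 < e / 3 by rewrite divr_gt0.
  have [N uN] := lim _ e3.
  have /continuous_distP/(_ x _ e3) := (cvalP (u N)).1.
  apply: filterS => y uy.
  have -> : l x - l y = - (cval (u N) x - l x)
    + (cval (u N) x - cval (u N) y) + (cval (u N) y - l y).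
    by ring.
  have -> : e = e / 3 + e / 3 + e / 3 by field.
  apply: (le_lt_trans (ler_normD _ _)); apply: ltr_leD; last exact: uN.
  by apply: (le_lt_trans (ler_normD _ _)); apply: ler_ltD; rewrite ?normrN ?uN.
have bl : exists M, forall x, `|l x| <= M.
  have [N uN] := lim 1 ltr01; have [M uM] := (cvalP (u N)).2.
  exists (M + 1) => x; rewrite -(subrK (cval (u N) x) (l x)) addrC.
  by rewrite (le_trans (ler_normD _ _))// lerD// distrC uN.
(* The uniform estimates are not strict; halving [e] restores the strict inequality. *)
exists (toC cl bl) => e e0; have e2 : 0 < e / 2 by rewrite divr_gt0.
have [N uN] := lim _ e2; exists N => n Nn.
apply: (@le_lt_trans _ _ (e / 2)); last first.
  by rewrite ltr_pdivrMr// ltr_pMr// ltr1n.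
apply: lnorm_le; first exact: ltW.
apply/normB_le => x; rewrite cvalB; exact: uN.
Qed.

Definition function_ext (X : cregSpace) : basicExt R :=
  BasicExt (@CtoB_mono X) Bfun_basic (@CtoB_dense X).

(** For each [k], the open sets where [f - g < 1/(k+1)], with [f] in S and [g] in T, cover X.
    Countably many pairs suffice for all [k] together, and [interpolation] applies to their
    components. *)
Lemma function_ext_SL (X : cregSpace) : lindelof X -> SL (function_ext X).
Proof.
move=> lX S T s t Ss Tt st.
(* On the empty space any two functions are comparable, so empty subfamilies serve; a nonempty space
   provides the point required by [lindelof_seq]. *)
have [[x0 _]|X0] := pselect (exists x : X, True); last first.
  have le_all (u v : Bfun (R := R) X) : u <= v.
    by apply/bval_leP => x; case: X0; exists x.
  exists set0, set0, s, t, 0.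
  split; [by split|by split| | |by split; exact: le_all].
    by split=> ? ?; exact: le_all.
  by split=> ? ?; exact: le_all.
pose I := {fg : Cfun X * Cfun X | S fg.1 /\ T fg.2}.
pose gap (i : I) x : R := cval (sval i).1 x - cval (sval i).2 x.
have cgap i : continuous (gap i).
  by move=> x; apply: (@cvgB _ R^o); [exact: (cvalP _).1|exact: (cvalP _).1].
(* Evaluation at [x] is normal. If all gaps at [x] were at least [e], then [t x + e <= s x] would
   follow, against [s <= t]. *)
have cover x e : 0 < e -> exists i, gap i x < e.
  move=> e0; apply: contrapT => H.
  have gapST f g : S f -> T g -> e <= cval f x - cval g x.
    move=> Sf Tg; rewrite leNgt; apply/negP => fg; apply: H.
    by exists (exist _ (f, g) (conj Sf Tg)).
  have fx f : S f -> bval t x <= cval f x - e.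
    move=> Sf; rewrite -pev_eval_point; apply: (pev_sup Tt) => _ [g Tg <-].
    by rewrite pev_eval_point lerBrDr addrC -lerBrDr; exact: gapST.
  have : bval t x + e <= bval s x.
    rewrite -(pev_eval_point x s); apply: (pev_inf Ss) => _ [f Sf <-].
    by rewrite pev_eval_point -lerBrDr; exact: fx.
  by rewrite leNgt (le_lt_trans (bval_leP _ _ st x))// ltrDl.
have /choice[sq sqP] k : exists u : nat -> I,
    forall x, exists n, gap (u n) x < k.+1%:R^-1.
  apply: (lindelof_seq (V := fun i x => gap i x < k.+1%:R^-1) x0 lX).
    move=> i; rewrite -[X in open X]/(gap i @^-1` [set r | r < k.+1%:R^-1]).
    by apply: open_comp => [x _|]; [exact: cgap|exact: open_lt].
  by move=> x; exact: cover.
(* The doubly indexed family of pairs is listed as one sequence; numbers that code no pair are read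
   as [(0, 0)]. *)
pose dec m : nat * nat := odflt (0, 0)%N (unpickle m).
pose i_ m : I := sq (dec m).1 (dec m).2.
pose F m := (sval (i_ m)).1; pose G m := (sval (i_ m)).2.
have SF m : S (F m) by exact: (svalP (i_ m)).1.
have TG m : T (G m) by exact: (svalP (i_ m)).2.
have FG x e : 0 < e -> exists m, cval (F m) x < cval (G m) x + e.
  move=> e0; pose k := Num.bound `|e^-1|.
  have [n gk] := sqP k x; exists (pickle (k, n)).
  rewrite addrC -ltrBlDr.
  have -> : cval (F (pickle (k, n))) x - cval (G (pickle (k, n))) x
     = gap (sq k n) x by rewrite /gap /F /G /i_ /dec pickleK.
  apply: (lt_le_trans gk); rewrite invf_ple ?posrE//.
  by rewrite (le_trans (le_nat_bound _))// ler_nat.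
have sF m : s <= CtoB X (F m) by apply: Ss.1; exists (F m).
have Gt m : CtoB X (G m) <= t by apply: Tt.1; exists (G m).
have [M sM] := bvalP s; have [N tN] := bvalP t.
have GN m x : cval (G m) x <= N.
  exact: le_trans (bval_leP _ _ (Gt m) x) (le_trans (ler_norm _) (tN x)).
have MF m x : - M <= cval (F m) x.
  apply: le_trans (bval_leP _ _ (sF m) x).
  by have := sM x; rewrite ler_norml => /andP[].
have [a [ca aF aG]] := interpolation (fun m => (cvalP (F m)).1)
  (fun m => (cvalP (G m)).1) GN FG.
have ba : exists K, forall x, `|a x| <= K.
  exists (Num.max M N) => x; rewrite ler_norml lerNl !le_max lerNl.
  by rewrite (aF x (- M))// (aG x N)// orbT.
have [s' Ss'] : exists b, infimums (CtoB X @` range F) b.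
  apply: (@dedekind_infimums _ _ _ s).
    by exists (CtoB X (F 0%N)), (F 0%N) => //; exists 0%N.
  by move=> _ [_ [m _ <-] <-].
have [t' Tt'] : supremums (CtoB X @` range G) !=set0.
  apply: Bfun_dedekind; split.
    by exists (CtoB X (G 0%N)), (G 0%N) => //; exists 0%N.
  by exists t => _ [_ [m _ <-] <-].
exists (range F), (range G), s', t', (toC ca ba); split=> //.
- by split=> [_ [m _ <-] //|]; exact: card_image_le.
- by split=> [_ [m _ <-] //|]; exact: card_image_le.
- split; apply/bval_leP => x.
    apply: aF => m; apply: (bval_leP _ _ _ x : _ <= bval (CtoB X (F m)) x).
    by apply: Ss'.1; exists (F m) => //; exists m.
  apply: aG => m; apply: (bval_leP (CtoB X (G m)) _ _ x).
  by apply: Tt'.1; exists (G m) => //; exists m.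
Qed.

End function_extension.

(** * The spectrum of a basic extension *)

Section kernel_pair.
Context {R : realType}.
Variables (A B : balType R) (f : balHom A B).

Definition same_image : set (bool -> A) := [set u | f (u true) = f (u false)].

Lemma same_image_closed : lalg_closed same_image.
Proof.
split; rewrite /same_image/=.
- by [].
- by move=> u v uu vv; rewrite !balHomD uu vv.
- by move=> u v uu vv; rewrite !balHomM uu vv.
- by move=> r u uu; rewrite !balHomZ uu.
- by move=> u v uu vv; rewrite !balHom_meet uu vv.
- by move=> u v uu vv; rewrite !balHom_join uu vv.
- move=> u _; have [m um] := bal_bounded (u true).
  have [n un] := bal_bounded (u false); exists (m + n)%N => i.
  have nat_ge0 (k : nat) : 0 <= k%:R :> A.
    by rewrite -scaler_nat lalg_scaler_ge0 ?bal_ler01.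
  rewrite natrD; case: i.
    by rewrite -[u true]addr0; exact: lalg_lerD.
  by rewrite -[u false]add0r; exact: lalg_lerD.
Qed.

Definition kernel_pair : balType R := subpower_balType same_image_closed.

Definition kernel_proj (i : bool) : balHom kernel_pair A.
Proof.
by refine (@BalHom R kernel_pair A (fun u => sval u i) _ _ _ _ _ _).
Defined.

(** A monomorphism equalizes the two projections of its kernel pair, so these coincide; evaluating
    them at the pair [(a, b)] gives [a = b]. *)
Lemma is_mono_inj : @is_mono (bal R) A B f -> injective f.
Proof.
move=> mf a b fab.
have /(congr1 (fun h => bal_fun h)) e : kernel_proj true = kernel_proj false.
  by apply: mf; apply: balHom_eq; apply/funext => -[u uu]; exact: uu.
exact: (congr1 (fun h => h (exist _ (fun i => if i then a else b) fab)) e).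
Qed.

End kernel_pair.

(** * The space of points and its topology *)

Section spectrum.
Context {R : realType}.
Variable al : basicExt R.

Definition spec : Type := point (ext_cod al).

(** The Gelfand transform of [a]. *)
Definition hat (a : ext_dom al) (p : spec) : R := pev p (al a).

Implicit Types (p q : spec) (a b : ext_dom al) (r : R).

Lemma hat_cst r p : hat (r *: (1 : ext_dom al)) p = r.
Proof. by rewrite /hat balHomZ balHom1 pevZ1. Qed.

Lemma hat1 p : hat 1 p = 1.
Proof. by rewrite /hat balHom1 pev1. Qed.

Lemma hatZ r a p : hat (r *: a) p = r * hat a p.
Proof. by rewrite /hat balHomZ pevZ. Qed.

Lemma hatD a b p : hat (a + b) p = hat a p + hat b p.
Proof. by rewrite /hat balHomD pevD. Qed.

Lemma hatM a b p : hat (a * b) p = hat a p * hat b p.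
Proof. by rewrite /hat balHomM pevM. Qed.

Lemma hatN a p : hat (- a) p = - hat a p.
Proof. by rewrite -scaleN1r hatZ mulN1r. Qed.

Lemma hat0 p : hat 0 p = 0.
Proof. by rewrite -(scale0r 0) hatZ mul0r. Qed.

Lemma hatB a b p : hat (a - b) p = hat a p - hat b p.
Proof. by rewrite hatD hatN. Qed.

Lemma hat_meet a b p : hat (Order.meet a b) p = Num.min (hat a p) (hat b p).
Proof. by rewrite /hat balHom_meet pev_meet. Qed.

Lemma hat_join a b p : hat (Order.join a b) p = Num.max (hat a p) (hat b p).
Proof. by rewrite /hat balHom_join pev_join. Qed.

Lemma hat_bounded a : exists M, forall p, `|hat a p| <= M.
Proof. exact: pev_bounded. Qed.

Definition spec_open : set (set spec) := [set U | forall p, U p ->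
  exists2 a, 0 < hat a p & forall q, 0 < hat a q -> U q].

Fact spec_openT : spec_open setT.
Proof. by move=> p _; exists 1; rewrite ?hat1. Qed.

Fact spec_openI : setI_closed spec_open.
Proof.
move=> U V oU oV p [/oU[a ap aU] /oV[b bp bV]].
exists (Order.meet a b) => [|q]; rewrite hat_meet lt_min ?ap ?bp//.
by move=> /andP[/aU Uq /bV Vq].
Qed.

Fact spec_open_bigU (I : Type) (f : I -> set spec) :
  (forall i, spec_open (f i)) -> spec_open (\bigcup_i f i).
Proof.
by move=> fo p [i _ /fo[a ap aU]]; exists a => // q /aU fq; exists i.
Qed.

HB.instance Definition _ := gen_eqMixin spec.
HB.instance Definition _ := gen_choiceMixin spec.
HB.instance Definition _ := isOpenTopological.Build spec
  spec_openT spec_openI spec_open_bigU.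

Lemma spec_openE (U : set spec) : open U = spec_open U.
Proof. by []. Qed.

Lemma hat_gt0_open a : open [set p | 0 < hat a p].
Proof. by rewrite spec_openE => p /= ap; exists a. Qed.

Lemma nbhs_specP p (U : set spec) : nbhs p U <->
  exists2 a, 0 < hat a p & forall q, 0 < hat a q -> U q.
Proof.
split=> [|[a ap aU]].
  rewrite nbhsE => -[V [oV Vp] VU]; have [a ap aV] := (oV : spec_open V) p Vp.
  by exists a => // q /aV/VU.
by apply: filterS aU _; apply: open_nbhs_nbhs; split=> //; exact: hat_gt0_open.
Qed.

Lemma hat_continuous a : continuous (hat a).
Proof.
apply/continuous_distP => p e e0; apply/nbhs_specP.
(* This element takes the value [e - |hat a q - hat a p|] at [q]. *)
exists (Order.meet (e *: (1 : ext_dom al) - (a - hat a p *: (1 : ext_dom al)))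
                   (e *: (1 : ext_dom al) + (a - hat a p *: (1 : ext_dom al)))).
  by rewrite hat_meet !(hatD, hatN, hat_cst) subrr subr0 addr0 lt_min e0.
move=> q; rewrite hat_meet !(hatD, hatN, hat_cst) lt_min => /andP[h1 h2].
by rewrite ltr_norml; apply/andP; split; lra.
Qed.

(** Every element of B is a join of meets from A, and points preserve joins and meets, so their
    values on A determine them. *)
Lemma hat_separates p q : (forall a, hat a p = hat a q) -> p = q.
Proof.
move=> pq; apply: point_ext => b; have [D Dinf Db] := @ext_dense R al b.
have le p' q' : (forall a, hat a p' = hat a q') -> pev p' b <= pev q' b.
  move=> pq'; apply: (pev_sup Db) => d Dd; have [S Sd] := Dinf _ Dd.
  apply: (@le_trans _ _ (pev q' d)); last exact/pev_le/Db.1.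
  apply: (pev_inf Sd) => _ [a Sa <-]; rewrite -[leRHS]pq'.
  by apply: pev_le; apply: Sd.1; exists a.
by apply: le_anti; rewrite !le.
Qed.

Lemma spec_hausdorff : hausdorff_space spec.
Proof.
rewrite open_hausdorff => p q pq.
have [a apq] : exists a, hat a p < hat a q.
  apply: contrapT => H; move/eqP: pq; apply; apply: hat_separates => a.
  apply: le_anti; apply/andP; split; rewrite leNgt; apply/negP => h; apply: H.
    by exists (- a); rewrite !hatN ltrN2.
  by exists a.
pose m := (hat a p + hat a q) / 2.
exists ([set x | 0 < hat (m *: (1 : ext_dom al) - a) x],
        [set x | 0 < hat (a - m *: (1 : ext_dom al)) x]).
  by split; rewrite inE /= hatB hat_cst /m; lra.
split; try exact: hat_gt0_open.
apply/eqP; rewrite -subset0 => x /= []; rewrite !hatB !hat_cst => h1 h2.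
by lra.
Qed.

(** Divide an element whose cozero set witnesses the neighbourhood by its value at [p], then
    truncate to [0, 1]. *)
Lemma spec_bump p (U : set spec) : nbhs p U ->
  exists c, [/\ hat c p = 1, forall q, 0 <= hat c q, forall q, hat c q <= 1 &
    forall q, 0 < hat c q -> U q].
Proof.
move=> /nbhs_specP[a ap aU].
exists (Order.meet (Order.join ((hat a p)^-1 *: a) 0) 1).
have cE q : hat (Order.meet (Order.join ((hat a p)^-1 *: a) 0) 1) q
    = Num.min (Num.max ((hat a p)^-1 * hat a q) 0) 1.
  by rewrite hat_meet hat1 hat_join hatZ hat0.
split=> [|q|q|q]; rewrite cE.
- by rewrite mulVf ?gt_eqF// max_l ?ler01// minxx.
- by rewrite le_min le_max lexx orbT ler01.
- by rewrite ge_min lexx orbT.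
- rewrite lt_min lt_max ltxx orbF => /andP[+ _].
  by rewrite pmulr_rgt0 ?invr_gt0//; exact: aU.
Qed.

Lemma spec_completely_regular : completely_regular_space spec.
Proof.
move=> p B cB Bp; apply/(@uniform_separatorP _ R).
have [c [cp c0 c1 cB']] : exists c, [/\ hat c p = 1, forall q, 0 <= hat c q,
    forall q, hat c q <= 1 & forall q, 0 < hat c q -> (~` B) q].
  by apply: spec_bump; apply: open_nbhs_nbhs; split=> //; exact: closed_openC.
exists (hat (1 - c)); split; first exact: hat_continuous.
- by move=> _ [q _ <-]; rewrite /= in_itv/= hatB hat1 subr_ge0 c1 gerBl c0.
- by move=> _ [_ -> <-]; rewrite /= hatB hat1 cp subrr.
- move=> _ [q Bq <-]; rewrite /= hatB hat1.
  suff -> : hat c q = 0 by rewrite subr0.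
  by apply/eqP; rewrite eq_le c0 andbT leNgt; apply/negP => /cB'; exact.
Qed.

Definition spec_space : cregSpace :=
  CregSpace spec_hausdorff spec_completely_regular.

End spectrum.

(** * Bijective homomorphisms and isomorphisms of extensions *)

Section balHom_inverse.
Context {R : realType}.
Variables (A B : balType R) (f : balHom A B).

Lemma balHom_le a b : a <= b -> f a <= f b.
Proof. by rewrite leEmeet => /eqP ab; rewrite leEmeet -balHom_meet ab. Qed.

Hypotheses (f_inj : injective f) (f_surj : forall b, exists a, f a = b).

Definition balHom_preim (b : B) : A := sval (cid (f_surj b)).

Lemma balHom_preimK b : f (balHom_preim b) = b.
Proof. exact: svalP (cid (f_surj b)). Qed.

Lemma balHom_preim_eq a b : f a = b -> balHom_preim b = a.
Proof. by move=> fab; apply: f_inj; rewrite balHom_preimK. Qed.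

Definition balHom_inv : balHom B A.
Proof.
refine (@BalHom R B A balHom_preim _ _ _ _ _ _) => [a b|a b||r a|a b|a b].
- by apply: balHom_preim_eq; rewrite balHomD !balHom_preimK.
- by apply: balHom_preim_eq; rewrite balHomM !balHom_preimK.
- by apply: balHom_preim_eq; rewrite balHom1.
- by apply: balHom_preim_eq; rewrite balHomZ !balHom_preimK.
- by apply: balHom_preim_eq; rewrite balHom_meet !balHom_preimK.
- by apply: balHom_preim_eq; rewrite balHom_join !balHom_preimK.
Defined.

Lemma balHom_inv_normal : normal_hom balHom_inv.
Proof.
move=> S b [ub lub]; split=> [_ [s Ss <-]|u Su].
  by move: (ub _ Ss); rewrite !leEmeet => /eqP sb;
    rewrite -balHom_meet sb.
have : b <= f u.
  apply: lub => s Ss; rewrite -(balHom_preimK s); apply: balHom_le.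
  by apply: Su; exists s.
rewrite !leEmeet => /eqP bu; apply/eqP; apply: f_inj.
by rewrite balHom_meet balHom_preimK.
Qed.

End balHom_inverse.

(** An injective homomorphism reflects the order, because [a <= b] is the equation [a /\ b = a];
    pulling an upper bound back then preserves joins. *)
Lemma balHom_inj_normal (R : realType) (A B : balType R) (f : balHom A B) :
  injective f -> (forall b, exists a, f a = b) -> normal_hom f.
Proof.
move=> f_inj f_surj S a [ub lub]; split=> [_ [s Ss <-]|u Su].
  exact/balHom_le/ub.
have [v vu] := f_surj u; rewrite -vu; apply: balHom_le; apply: lub => s Ss.
rewrite leEmeet; apply/eqP; apply: f_inj; rewrite balHom_meet; apply/eqP.
by rewrite -leEmeet vu; apply: Su; exists s.
Qed.

Lemma basicHom_iso (R : realType) (al be : lbasic R) (h : hom al be) :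
  injective (hom_dom h) -> (forall b, exists a, hom_dom h a = b) ->
  injective (hom_cod h) -> (forall b, exists a, hom_cod h a = b) -> is_iso h.
Proof.
move=> di ds ci cs.
have sq : balHom_comp (balHom_inv ci cs) (sval be)
    = balHom_comp (sval al) (balHom_inv di ds).
  apply: balHom_eq; apply/funext => b; apply: balHom_preim_eq => //.
  have /(congr1 (fun k => bal_fun k (balHom_preim ds b))) /= -> := hom_square h.
  by rewrite balHom_preimK.
exists (@BasicHom R (sval be) (sval al) _ _ (balHom_inv_normal ci cs) sq).
split; apply: basicHom_eq; apply: balHom_eq; apply/funext => b /=;
  by [exact: balHom_preim_eq|exact: balHom_preimK].
Qed.

(** * The Gelfand representation of an extension satisfying (SL) *)

Section gelfand.
Context {R : realType}.
Variable al : basicExt R.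
Hypothesis slal : SL al.

Let A := ext_dom al.
Let B := ext_cod al.
Let X := spec_space al.
Let bB : basic_algebra B := @ext_basic R al.

(** With a bump [c] at [p] supported where [f < f p + d], the element mixes the constants [M + d]
    and [f p + d] with weights [1 - c] and [c]. Both constants dominate [f] wherever their weight is
    positive. *)
Lemma hat_approx (f : X -> R) (M : R) p d : continuous f ->
  (forall q, f q <= M) -> 0 < d ->
  exists a : A, (forall q, f q <= hat a q) /\ hat a p = f p + d.
Proof.
move=> cf fM d0.
have /spec_bump[c [cp c0 c1 cf']] : \forall q \near p, f q < f p + d.
  have /continuous_distP/(_ p d d0) := cf.
  apply: filterS => q; rewrite distrC => /(le_lt_trans (ler_norm _)).
  by rewrite ltrBlDl.
exists ((M + d) *: (1 : A) - (M - f p) *: c).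
have aE q : hat ((M + d) *: (1 : A) - (M - f p) *: c) q =
    (1 - hat c q) * (M + d) + hat c q * (f p + d).
  by rewrite hatB hat_cst hatZ; ring.
split=> [q|]; rewrite aE; last by rewrite cp subrr mul0r add0r mul1r.
rewrite -[leLHS]mul1r -{1}(subrK (hat c q) 1) mulrDl; apply: lerD.
  apply: ler_wpM2l; first by rewrite subr_ge0.
  by rewrite (le_trans (fM q))// lerDl ltW.
have := c0 q; rewrite le_eqVlt => /orP[/eqP <-|cq]; first by rewrite !mul0r.
by rewrite ler_wpM2l// ltW// cf'.
Qed.

Lemma hat_surj (f : Cfun (R := R) X) :
  exists a : A, forall p, hat a p = cval f p.
Proof.
have [cf [M fM]] := cvalP f.
have fM1 q : cval f q <= M by exact: le_trans (ler_norm _) (fM q).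
have fM2 q : - cval f q <= M.
  by rewrite (le_trans _ (fM q))// -normrN ler_norm.
have cNf : continuous (fun p => - cval f p).
  by move=> p; exact: (@cvgN _ R^o _ _ _ (cval f) _ (cf p)).
have [b bE] := point_realize bB fM.
pose S := [set a : A | forall q, cval f q <= hat a q].
pose T := [set a : A | forall q, hat a q <= cval f q].
have Sb : infimums (al @` S) b.
  apply: infimums_point => // [_ [a Sa <-]|p r H].
    by apply: point_leP => // p; rewrite bE; exact: Sa.
  apply/ler_addgt0Pr => d d0; have [a [fa ap]] := hat_approx p cf fM1 d0.
  by rewrite bE -ap; apply: H; exists a.
have Tb : supremums (al @` T) b.
  apply: supremums_point => // [_ [a Ta <-]|p r H].
    by apply: point_leP => // p; rewrite bE; exact: Ta.
  (* Approximations from below are opposites of approximations of [- f] from above. *)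
  apply/ler_addgt0Pr => d d0; have [a [fa ap]] := hat_approx p cNf fM2 d0.
  rewrite bE -lerBlDr.
  have -> : cval f p - d = hat (- a) p by rewrite hatN ap opprD opprK.
  by apply: H; exists (- a) => // q; rewrite hatN lerNl; exact: fa.
(* Both sides of the (SL) inequality are [b], so that [b <= s' <= al a <= t' <= b]. *)
have [S' [T' [s' [t' [a [[S'S _] [T'T _] S's' T't' [sa at_]]]]]]] :=
  slal Sb Tb (lexx b).
exists a => p; rewrite /hat -bE; congr (pev p _); apply: le_anti.
apply/andP; split.
  apply: (le_trans at_); apply: T't'.2 => _ [c Tc <-].
  by apply: Tb.1; exists c => //; exact: T'T.
apply: le_trans sa; apply: S's'.2 => _ [c Sc <-].
by apply: Sb.1; exists c => //; exact: S'S.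
Qed.

Lemma spec_lindelof : lindelof X.
Proof.
move=> U oU cU.
pose T := [set a : A | (forall q, hat a q <= 1) /\
  exists2 W, U W & forall q, 0 < hat a q -> W q].
(* At each point [p], a bump supported in a member of the cover belongs to T and has the value 1
   there. *)
have T1 : supremums (al @` T) (al 1).
  apply: supremums_point => // [_ [a Ta <-]|p r H].
    by apply: point_leP => // p; rewrite -!/(hat _ _) hat1; exact: Ta.1.
  have [W UW Wp] : (\bigcup_(W in U) W) p by rewrite cU.
  have /spec_bump[c [cp c0 c1 cW]] : nbhs (p : X) W.
    by apply: open_nbhs_nbhs; split=> //; exact: oU.
  rewrite -/(hat _ _) hat1 -cp; apply: H; exists c => //.
  by split=> //; exists W.
have S1 : infimums (al @` [set 1]) (al 1) by rewrite image_set1 infimums1.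
have [S' [T' [s' [t' [a [[S'1 _] [T'T cT'] S's' T't' [sa at_]]]]]]] :=
  slal S1 T1 (lexx _).
(* All members of S' are 1, so [al 1] is a lower bound of the image of S' even when S' is empty. *)
have t1 : al 1 <= t'.
  apply: le_trans at_; apply: le_trans sa; apply: S's'.2 => _ [c /S'1 -> <-].
  exact: lexx.
have /choice[w wP] (a0 : A) : exists W, T a0 ->
    U W /\ forall q, 0 < hat a0 q -> W q.
  have [[_ [W UW aW]]|H] := pselect (T a0); first by exists W.
  by exists set0.
exists (w @` T'); split.
- by move=> _ [c /T'T/wP[Uw _] <-].
- exact: (sub_countable (card_image_le _ _) cT').
(* At a point left uncovered all members of T' would be nonpositive, and by normality so would [t'],
   although [al 1 <= t']. *)
- apply/seteqP; split=> // p _; apply: contrapT => H.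
  have : pev p t' <= 0.
    apply: (pev_sup T't') => _ [c Tc <-]; rewrite leNgt; apply/negP => cp.
    by apply: H; exists (w c); [exists c|have [_] := wP c (T'T _ Tc); exact].
  apply/negP; rewrite -ltNge; apply: (lt_le_trans ltr01).
  by rewrite -(hat1 p) /hat; exact: pev_le.
Qed.

Definition gelfand_dom : balHom A (Cfun X).
Proof.
refine (@BalHom R A (Cfun X)
  (fun a => toC (@hat_continuous R al a) (hat_bounded a)) _ _ _ _ _ _)
  => [a b|a b||r a|a b|a b]; apply: cval_ext => p.
- exact: hatD.
- exact: hatM.
- exact: hat1.
- exact: hatZ.
- exact: hat_meet.
- exact: hat_join.
Defined.

Definition gelfand_cod : balHom B (Bfun X).
Proof.
refine (@BalHom R B (Bfun X)
  (fun b => toB (pev_bounded b)) _ _ _ _ _ _)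
  => [a b|a b||r a|a b|a b]; apply: bval_ext => p.
- exact: pevD.
- exact: pevM.
- exact: pev1.
- exact: pevZ.
- exact: pev_meet.
- exact: pev_join.
Defined.

Lemma gelfand_domE a p : cval (gelfand_dom a) p = hat a p.
Proof. by []. Qed.

Lemma gelfand_codE b p : bval (gelfand_cod b) p = pev p b.
Proof. by []. Qed.

Lemma gelfand_cod_inj : injective gelfand_cod.
Proof.
move=> a b ab; apply: (point_inj bB) => p.
by rewrite -!gelfand_codE ab.
Qed.

Lemma gelfand_cod_surj f : exists b, gelfand_cod b = f.
Proof.
have [M fM] := bvalP f; have [b bf] := point_realize bB fM.
by exists b; apply: bval_ext => p; rewrite gelfand_codE bf.
Qed.

(** Points separate the elements of B, and the extension itself is injective because it is a
    monomorphism. *)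
Lemma gelfand_dom_inj : injective gelfand_dom.
Proof.
move=> a b ab; apply: (is_mono_inj (@ext_mono R al)).
by apply: (point_inj bB) => p; rewrite -[LHS]gelfand_domE ab.
Qed.

Lemma gelfand_dom_surj f : exists a, gelfand_dom a = f.
Proof.
have [a af] := hat_surj f.
by exists a; apply: cval_ext => p; rewrite gelfand_domE af.
Qed.

Definition gelfand : basicHom al (function_ext X).
Proof.
apply: (@BasicHom R al (function_ext X) gelfand_dom gelfand_cod).
  exact: balHom_inj_normal gelfand_cod_inj gelfand_cod_surj.
by apply: balHom_eq; apply/funext => a; apply: bval_ext => p.
Defined.

End gelfand.

(** * The equivalence *)

Section functors.
Context {R : realType}.

(** The value of [b \o h] at [x] is that of [b] at [h x], and evaluation at [h x] is normal. *)
Lemma precompB_normal (X Y : cregSpace) (h : X -> Y) :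
  normal_hom (precompB (R := R) h).
Proof.
move=> S b Sb; apply: supremums_bval => [_ [f Sf <-]|x r H].
  exact/balHom_le/Sb.1.
have : bval b (h x) <= r; last by [].
rewrite -pev_eval_point; apply: (pev_sup Sb) => f Sf; rewrite pev_eval_point.
by apply: (H (precompB h f)); exists f.
Qed.

Definition function_hom (X Y : cregSpace) (h : cregMap X Y) :
  basicHom (function_ext (R := R) Y) (function_ext X).
Proof.
refine (@BasicHom R (function_ext Y) (function_ext X)
  (precompC (@creg_cont X Y h)) (precompB h) _ _).
  exact: precompB_normal.
by apply: balHom_eq; apply/funext => f; apply: bval_ext => x.
Defined.

Definition function_functor : functor (op_category Lind) (lbasic R).
Proof.
refine (@Functor (op_category Lind) (lbasic R)
  (fun X => exist _ (function_ext (sval X))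
    (conj (@Cfun_complete R (sval X)) (function_ext_SL (svalP X))))
  (fun X Y h => function_hom h) _ _).
- by move=> X; apply: basicHom_eq; apply: balHom_eq; apply/funext => f;
    [apply: cval_ext|apply: bval_ext].
- by move=> X Y Z g h; apply: basicHom_eq; apply: balHom_eq; apply/funext => f;
    [apply: cval_ext|apply: bval_ext].
Defined.

Section spec_map.
Variables (al be : basicExt R) (h : basicHom al be).

Lemma comp_normal (p : spec be) : normal_hom (balHom_comp (sval p) (hom_cod h)).
Proof.
move=> S b Sb; have /= := (svalP p) _ _ (hom_normal h Sb).
by rewrite -image_comp.
Qed.

Definition spec_map (p : spec be) : spec al := exist _ _ (comp_normal p).

Lemma pev_spec_map p b : pev (spec_map p) b = pev p (hom_cod h b).
Proof. by []. Qed.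

Lemma hat_spec_map a p : hat a (spec_map p) = hat (hom_dom h a) p.
Proof.
rewrite /hat pev_spec_map; congr (pev p _).
exact: (congr1 (fun k => bal_fun k a) (hom_square h)).
Qed.

(** By the commuting square, the preimage of the basic open set of [a] is the basic open set of
    [hom_dom h a]. *)
Lemma spec_map_continuous : continuous spec_map.
Proof.
move=> p U /nbhs_specP[a ap aU]; apply/nbhs_specP; exists (hom_dom h a).
  by rewrite -hat_spec_map.
by move=> q; rewrite -hat_spec_map; exact: aU.
Qed.

Definition spec_cregMap : cregMap (spec_space be) (spec_space al) :=
  @CregMap (spec_space be) (spec_space al) _ spec_map_continuous.

End spec_map.

Definition spec_functor : functor (lbasic R) (op_category Lind).
Proof.
refine (@Functor (lbasic R) (op_category Lind)
  (fun al => exist _ (spec_space (sval al)) (spec_lindelof (svalP al).2))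
  (fun al be h => spec_cregMap h) _ _).
- by move=> al; apply: cregMap_eq; apply/funext => p; apply: point_ext.
- by move=> al be ga g h; apply: cregMap_eq; apply/funext => p;
    apply: point_ext.
Defined.

(** * A completely regular space is the spectrum of its function extension *)

Section evaluation.
Variable X : cregSpace.

Definition eval_spec (x : X) : spec (function_ext (R := R) X) := eval_point x.

Lemma eval_spec_continuous : continuous eval_spec.
Proof.
move=> x U /nbhs_specP[f fx fU].
have [cf _] := cvalP f.
have f0 : nbhs (cval f x) [set r | 0 < r].
  by apply: open_nbhs_nbhs; split; [exact: open_gt|exact: fx].
have : nbhs x (cval f @^-1` [set r | 0 < r]) by exact: cf f0.
by apply: (@filterS _ (nbhs x)) => y fy; exact: fU.
Qed.

(** The atom [e] carrying [p] is nonzero at some [x]; evaluating [b e = p(b) e] at [x] and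
    cancelling shows that [p] is evaluation at [x]. *)
Lemma eval_spec_surj (p : spec (function_ext (R := R) X)) :
  exists x, eval_spec x = p.
Proof.
have Bd : basic_algebra (Bfun (R := R) X) := Bfun_basic.
have [e [pe e0 e1 eE]] := point_atom Bd p.
have [x ex] : exists x, bval e x <> 0.
  apply: contrapT => H; have : e = 0.
    apply: bval_ext => x; rewrite bval0; apply: contrapT => ex.
    by apply: H; exists x.
  by move=> e00; move: pe; rewrite e00 pev0 => /esym/eqP; rewrite oner_eq0.
exists x; apply: point_ext => b.
have : bval b x * bval e x = pev p b * bval e x.
  exact: (congr1 (fun f => bval f x) (eE b)).
by apply: mulIf; apply/eqP.
Qed.

Lemma eval_spec_inj : injective eval_spec.
Proof.
move=> x y xy; apply: contrapT => nxy.
have : bval (spike 0 x 1) x = bval (spike 0 x 1) y :> R.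
  exact: (congr1 (fun p => pev p (spike 0 x 1)) xy).
rewrite [LHS]update_eq [RHS]update_neq; last by move=> /esym.
by move/eqP; rewrite oner_eq0.
Qed.

Definition unspec (p : spec (function_ext (R := R) X)) : X :=
  sval (cid (eval_spec_surj p)).

Lemma unspecK p : eval_spec (unspec p) = p.
Proof. exact: svalP (cid (eval_spec_surj p)). Qed.

Lemma eval_specK x : unspec (eval_spec x) = x.
Proof. by apply: eval_spec_inj; rewrite unspecK. Qed.

(** Complete regularity makes the cozero sets of bounded continuous functions a base of X: if [g] is
    0 at [x] and 1 off V, then [1 - g] is positive only inside V. *)
Lemma unspec_continuous : continuous unspec.
Proof.
move=> p U; set x := unspec p.
rewrite nbhsE => -[V [oV Vx] VU].
have /(@uniform_separatorP _ R)[g [cg g01 g0 g1]] :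
    uniform_separator [set x] (~` V).
  by apply: creg_regular; [exact: open_closedC|by move=> /(_ Vx)].
have gx : g x = 0 by apply: g0; exists x.
have bg : exists M, forall z, `|g z| <= M.
  exists 1 => z; have := g01 (g z); rewrite /= in_itv => /(_ _)/andP[].
    by exists z.
  by move=> gz0 gz1; rewrite ger0_norm.
pose f : Cfun X := 1 - toC cg bg.
have fE q : hat (al := function_ext X) f q = 1 - g (unspec q).
  by rewrite -{1}(unspecK q); exact: cvalB.
apply/nbhs_specP; exists f; first by rewrite fE gx subr0.
move=> q; rewrite fE => gq; apply: VU; apply: contrapT => Vq.
by move: gq; rewrite (g1 (g (unspec q))) ?subrr ?ltxx//; exists (unspec q).
Qed.

Definition eval_cregMap : cregMap X (spec_space (function_ext X)) :=
  @CregMap X (spec_space (function_ext X)) _ eval_spec_continuous.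

Definition unspec_cregMap : cregMap (spec_space (function_ext X)) X :=
  @CregMap (spec_space (function_ext X)) X _ unspec_continuous.

End evaluation.

Lemma spec_function_iso : naturally_isomorphic
  (comp_functor spec_functor function_functor) (id_functor (op_category Lind)).
Proof.
(* In the opposite category a morphism from the spectrum to X is a continuous map from X to the
   spectrum. *)
exists (fun X : Lind => eval_cregMap (sval X)); split=> [X|X Y h].
  exists (unspec_cregMap (sval X)).
  split; apply: cregMap_eq; apply/funext => x.
    exact: unspecK.
  exact: eval_specK.
by apply: cregMap_eq; apply/funext => x; apply: point_ext.
Qed.

Lemma function_spec_iso : naturally_isomorphic
  (id_functor (lbasic R)) (comp_functor function_functor spec_functor).
Proof.
exists (fun al : lbasic R => gelfand (sval al)); split=> [al|al be h].
  apply: basicHom_iso.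
  - exact: gelfand_dom_inj.
  - exact: gelfand_dom_surj (svalP al).2.
  - exact: gelfand_cod_inj.
  - exact: gelfand_cod_surj.
apply: basicHom_eq; apply: balHom_eq; apply/funext => a.
  by apply: cval_ext => p; exact: esym (hat_spec_map h a p).
by apply: bval_ext => p.
Qed.

End functors.

Theorem theorem4p18 (R : realType) : dually_equivalent Lind (lbasic R).
Proof.
exists function_functor, spec_functor; split; first exact: spec_function_iso.
exact/naturally_isomorphic_sym/function_spec_iso.
Qed.
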